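(* Let $A,B\subseteq\{0,1\}^*$ and $g:\{0,1\}^*\to\{0,1\}^*$ be such that $B$ is $\mathrm{p}^g$-selective and $A\le^P_m B$. Then $\dim^g_{\mathrm{p}}(A)=0$.
   Context: $\mathrm{p}^g$ denotes the class of functions $\{0,1\}^*\to\{0,1\}^*$ computable in polynomial time by an oracle Turing machine with oracle access to the function $g$. A language $B$ is $\mathrm{p}^g$-selective if there is a selector $f\in\mathrm{p}^g$ such that for all $a,b\in\{0,1\}^*$, $f(\langle a,b\rangle)\in\{a,b\}$ and ($a\in B$ or $b\in B$) implies $f(\langle a,b\rangle)\in B$, where $\langle\cdot,\cdot\rangle$ is a standard pairing function. $A\le^P_m B$ means there is a polynomial-time computable $h$ with $x\in A\iff h(x)\in B$. With $s_0,s_1,\dots$ the standard length-lexicographic enumeration of $\{0,1\}^*$, a language $A$ is identified with its characteristic sequence (bit $n$ is $1$ iff $s_n\in A$) and $A\upharpoonright n$ is its length-$n$ prefix. For $s\ge0$, an $s$-gale is $d:\{0,1\}^*\to[0,\infty)$ with $d(w)=2^{-s}[d(w0)+d(w1)]$ for all $w$; it succeeds on $A$ if $\limsup_n d(A\upharpoonright n)=\infty$. $d$ is $\mathrm{p}^g$-computable if there is $\hat d:\{0,1\}^*\times\mathbb{N}\to\mathbb{Q}\cap[0,\infty)$ in $\mathrm{p}^g$ ($r$ in unary) with $|\hat d(w,r)-d(w)|\le2^{-r}$. $\dim^g_{\mathrm{p}}(A)$ is the infimum of all $s\ge0$ such that some $\mathrm{p}^g$-computable $s$-gale succeeds on $A$.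 *)

(* Defs.v *)
From HB Require Import structures.
From mathcomp Require Import all_boot all_order all_algebra.
From mathcomp Require Import all_classical all_reals all_analysis.

Set Implicit Arguments.
Unset Strict Implicit.
Unset Printing Implicit Defensive.

Import Order.TTheory GRing.Theory Num.Theory.

Local Open Scope classical_set_scope.
Local Open Scope ring_scope.

Definition word := seq bool.

(* ** Oracle Turing machines
   A multitape machine has an input, an output, a query and an answer tape
   together with a finite family of work tapes.  All tapes are two-way infinite
   and all of them may be read and written. *)

Inductive port := Input | Output | Query | Answer.

Definition bits_of_port (p : port) : bool * bool :=
  match p with
  | Input => (false, false) | Output => (false, true)
  | Query => (true, false) | Answer => (true, true)
  end.

Definition port_of_bits (c : bool * bool) : port :=
  match c with
  | (false, false) => Input | (false, true) => Output
  | (true, false) => Query | (true, true) => Answer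
  end.

Lemma bits_of_portK : cancel bits_of_port port_of_bits.
Proof. by case. Qed.

HB.instance Definition _ := Finite.copy port (can_type bits_of_portK).

Inductive move := MoveLeft | Stay | MoveRight.

Section Tapes.

(* [None] is the blank, [Some (inl b)] the bit [b], and [Some (inr c)] an
   additional symbol of the machine. *)
Definition symbol (Gamma : finType) : finType := option (bool + Gamma).

Variable Gamma : finType.

(* The pair [(l, r)] is the tape carrying [r] from the scanned cell rightwards
   and [l] from its left neighbour leftwards; all other cells are blank. *)
Definition tape : Type := seq (symbol Gamma) * seq (symbol Gamma).

Definition blank_tape : tape := ([::], [::]).

Definition scanned (t : tape) : symbol Gamma := head None t.2.

Definition write (a : symbol Gamma) (t : tape) : tape := (t.1, a :: behead t.2).

Definition shift (m : move) (t : tape) : tape :=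
  match m with
  | MoveLeft => (behead t.1, head None t.1 :: t.2)
  | Stay => t
  | MoveRight => (head None t.2 :: t.1, behead t.2)
  end.

Definition word_tape (x : word) : tape := ([::], [seq Some (inl b) | b <- x]).

(* The word on a tape extends from the scanned cell rightwards up to, but
   excluding, the first cell that does not contain a bit. *)
Fixpoint leading_bits (s : seq (symbol Gamma)) : word :=
  if s is Some (inl b) :: s' then b :: leading_bits s' else [::].

Definition tape_word (t : tape) : word := leading_bits t.2.

End Tapes.

Arguments blank_tape {Gamma}.
Arguments word_tape {Gamma} x.

(* [ask q = Some q'] makes [q] a query state, from which the machine resumes in
   state [q']. *)
Record oracleTM := OracleTM {
  state : finType;
  extra : finType;
  work : finType;
  start : state;
  halted : pred state;
  ask : state -> option state;
  delta : state -> {ffun port + work -> symbol extra} ->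
          state * {ffun port + work -> symbol extra * move}
}.

Section Semantics.

Variables (M : oracleTM) (g : word -> word).

Definition config : Type :=
  (state M * {ffun port + work M -> tape (extra M)})%type.

Definition init (x : word) : config :=
  (start M,
   [ffun i => if i == inl Input then word_tape x else blank_tape]).

(* A query takes one step: it erases the query tape and replaces the answer
   tape by the oracle's answer. *)
Definition step (c : config) : config :=
  let: (q, T) := c in
  if halted q then c else
  if ask q is Some q' then
    (q', [ffun i => if i == inl Query then blank_tape
                    else if i == inl Answer
                         then word_tape (g (tape_word (T (inl Query))))
                    else T i])
  else
    let: (q', a) := delta q [ffun i => scanned (T i)] in
    (q', [ffun i => shift (a i).2 (write (a i).1 (T i))]).

Definition outputs_within (x y : word) (n : nat) : Prop :=
  exists t : nat, [/\ (t <= n)%N,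
    halted (iter t step (init x)).1 &
    tape_word ((iter t step (init x)).2 (inl Output)) = y].

Definition computes_in_polytime (f : word -> word) : Prop :=
  exists c k : nat, forall x, outputs_within x (f x) (c * size x ^ k + c)%N.

End Semantics.

(* The class p^g *)
Definition oracle_polytime (g f : word -> word) : Prop :=
  exists M : oracleTM, computes_in_polytime M g f.

(* Since the machine makes no query, the oracle chosen here is irrelevant. *)
Definition polytime (f : word -> word) : Prop :=
  exists M : oracleTM,
    (forall q : state M, ask q = None) /\
    computes_in_polytime M (fun=> [::]) f.

(* ** Selectivity and reducibility *)

(* Every bit of [a] is doubled, and [01] separates [a] from [b]. *)
Definition pairing (a b : word) : word :=
  flatten [seq [:: x; x] | x <- a] ++ [:: false; true] ++ b.

Definition selective (g : word -> word) (B : set word) : Prop :=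
  exists f : word -> word, oracle_polytime g f /\
    forall a b : word,
      (f (pairing a b) = a \/ f (pairing a b) = b) /\
      (B a \/ B b -> B (f (pairing a b))).

Definition poly_m_reducible (A B : set word) : Prop :=
  exists h : word -> word, polytime h /\ forall x, A x <-> B (h x).

(* ** Characteristic sequences *)

(* The length-lexicographic successor, on words written in reverse *)
Fixpoint rev_succ (x : word) : word :=
  match x with
  | [::] => [:: false]
  | false :: x' => true :: x'
  | true :: x' => false :: rev_succ x'
  end.

Definition std_word (n : nat) : word := rev (iter n rev_succ [::]).

Example std_word_first : map std_word (iota 0 8) =
  [:: [::]; [:: false]; [:: true];
      [:: false; false]; [:: false; true]; [:: true; false]; [:: true; true];
      [:: false; false; false]].
Proof. by []. Qed.

Definition char_prefix (A : set word) (n : nat) : word :=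
  mkseq (fun i => std_word i \in A) n.

(* ** Gales and dimension *)

(* Binary numerals, most significant bit first; leading zeros are allowed. *)
Definition nat_of_word (x : word) : nat :=
  foldl (fun (n : nat) (b : bool) => n.*2 + b)%N 0%N x.

(* A nonnegative rational is represented by a numerator and a nonzero
   denominator in binary, not necessarily in lowest terms. *)
Definition represents (x : word) (q : rat) : Prop :=
  exists u v : word, [/\ x = pairing u v, (0 < nat_of_word v)%N &
    q = (nat_of_word u)%:R / (nat_of_word v)%:R].

Section Gales.

Variable R : realType.

Definition gale (s : R) (d : word -> R) : Prop :=
  (forall w, 0 <= d w) /\
  (forall w, d w = 2 `^ (- s) * (d (rcons w false) + d (rcons w true))).

Definition succeeds (d : word -> R) (A : set word) : Prop :=
  limn_esup (fun n => (d (char_prefix A n))%:E) = +oo%E.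

Definition oracle_polytime_approx (g : word -> word)
    (dhat : word -> nat -> rat) : Prop :=
  exists F : word -> word, oracle_polytime g F /\
    forall w r, represents (F (pairing w (nseq r true))) (dhat w r).

Definition oracle_polytime_real (g : word -> word) (d : word -> R) : Prop :=
  exists dhat : word -> nat -> rat,
    [/\ forall w r, 0 <= dhat w r,
        oracle_polytime_approx g dhat &
        forall w r, `|ratr (dhat w r) - d w| <= 2 ^- r].

Definition dim_p (g : word -> word) (A : set word) : \bar R :=
  ereal_inf [set s%:E | s in [set s : R | 0 <= s /\
    exists d : word -> R,
      [/\ gale s d, oracle_polytime_real g d & succeeds d A]]].

End Gales.

(* Main.v *)
Require Import Defs.
From HB Require Import structures.
From mathcomp Require Import all_boot all_order all_algebra.
From mathcomp Require Import all_classical all_reals all_analysis.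
From mathcomp Require Import zify lra.

(* A many-one reduction h of A to B and a selector f for B leave few candidates
   for A on the block of the L = 2^k words of length k. Let the score of x be
   the number of words y of the block with f(<h y, h x>) <> h y. If x is in A,
   its score is at least the number t of words of the block outside A, and
   otherwise it is smaller than t: A restricted to the block is the set of words
   of score at least t, for some t <= L. Let mu be the product over the blocks
   of the uniform distributions on the L + 1 thresholds; it gives prefixes of A
   of length 2^K - 1 at least the measure prod_(k < K) 1 / (2^k + 1). With
   2^s = 1 + 2^-j, the s-gale d w = 2^(s |w|) mu w is then unbounded along A,
   for every j, and s tends to 0 as j grows.

   The values of d are rational numbers that are computed exactly. The machine
   that does so is obtained by compiling a program for a machine with finitely
   many stacks; the machines for f and h are simulated on two stacks per tape. *)

Set Implicit Arguments.
Unset Strict Implicit.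
Unset Printing Implicit Defensive.

(** * Stack machines *)

(** Say that [x] is preferred to [y] when [f(<h y, h x>) <> h y]. This relation need not be
    transitive, so a block cannot be sorted by it, but counting does not need an order: a word of
    [A] is preferred to every word outside [A], while a word outside [A] is preferred neither to a
    word of [A] nor to itself. Only this separates the two kinds of words by their scores. On a
    block the gale gains [2^(s L)] and loses at most the factor [L + 1], the number of thresholds;
    so any [s > 0] wins once the blocks are long. The chosen [s] make [2^s] rational, so that no
    power of it has to be approximated. A block that begins inside [w] has at most [|w|] words,
    because [L - 1] words precede it. Hence even the last block, which may reach beyond [w], can be
    scored completely in polynomial time. The oracle is arbitrary, and so is the length of its
    answers: no time bound permits scanning or erasing an answer cell by cell. This dictates the
    conventions for stacks and calls. *)

Section StackMachine.

Variables (Gamma wk : finType) (g : word -> word).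

Local Notation K := (port + wk)%type.
Local Notation A := (bool + Gamma)%type.

Fixpoint lead_inl (s : seq A) : word :=
  if s is inl b :: s' then b :: lead_inl s' else [::].

(* A tape is used as the stack of the nonblank cells from its head rightwards:
   whatever is to the left of the head or behind a blank cell is invisible, so
   that a stack of any height is emptied in one step, by writing a blank. *)
Fixpoint nonblank (s : seq (symbol Gamma)) : seq A :=
  if s is Some a :: s' then a :: nonblank s' else [::].

Definition store : Type := K -> seq A.

(* [inl (Some a)] pushes [a], [inl None] empties the stack, [inr true] pops it
   and [inr false] leaves it unchanged. *)
Definition action : finType := (option A + bool)%type.

Definition act (a : action) (s : seq A) : seq A :=
  match a with
  | inl (Some x) => x :: s
  | inl None => [::]
  | inr true => behead s
  | inr false => s
  end.

(* The operation [None] is an oracle query. *)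
Definition exec (o : option (K -> action)) (s : store) : store :=
  if o is Some a then fun k => act (a k) (s k) else
  fun k => if k == inl Query then [::] else
    if k == inl Answer then map inl (g (lead_inl (s (inl Query)))) else s k.

Definition tops (s : store) (k : K) : option A := ohead (s k).

(** The successor state [None] is the exit. Fragments are composed by redirecting it. *)
Record frag := Frag {
  fstate : finType;
  fstart : fstate;
  fbody : fstate -> (K -> option A) ->
          option fstate * option (K -> action)
}.

Definition fconfig (F : frag) : Type := (option (fstate F) * store)%type.

Definition fstep (F : frag) (c : fconfig F) : fconfig F :=
  if c.1 is Some q then
    let: (o, a) := fbody q (tops c.2) in (o, exec a c.2)
  else c.

(** A fragment that has reached its exit keeps its store, so [n] is only an upper bound for the
    running time. *)
Definition runs (F : frag) (s : store) (n : nat) (s' : store) : Prop :=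
  iter n (@fstep F) (Some (fstart F), s) = (None, s').

Lemma iter_fstep_None (F : frag) n s :
  iter n (@fstep F) (None, s) = (None, s).
Proof. by elim: n => //= n ->. Qed.

Lemma runs_le (F : frag) s n n' s' :
  runs F s n s' -> (n <= n')%N -> runs F s n' s'.
Proof.
by rewrite /runs => Fn le_nn'; rewrite -(subnK le_nn') iterD Fn iter_fstep_None.
Qed.

(** ** Compilation to oracle Turing machines *)

Section Compile.

Variable F : frag.

(** A push has to move left before it can write, so each stack operation takes two machine steps.
    The second summand holds the states in between, with the pending action; there [None] is a
    pending query. *)
Definition tm_state : finType :=
  (option (fstate F) +
   option (fstate F) * option {ffun K -> action})%type.

(** Popping an empty stack must not move the head: the cells behind the blank may hold remains of an
    emptied stack. *)
Definition phase1 (a : action) (x : symbol Gamma) : symbol Gamma * move :=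
  match a with
  | inl (Some _) => (x, MoveLeft)
  | inl None => (None, Stay)
  | inr true => (x, if x is Some _ then MoveRight else Stay)
  | inr false => (x, Stay)
  end.

Definition phase2 (a : action) (x : symbol Gamma) : symbol Gamma * move :=
  (if a is inl (Some y) then Some y else x, Stay).

Definition tm_ask (q : tm_state) : option tm_state :=
  if q is inr (o, None) then Some (inl o) else None.

Definition tm_delta (q : tm_state) (t : {ffun K -> symbol Gamma}) :
    tm_state * {ffun K -> symbol Gamma * move} :=
  match q with
  | inl None => (q, [ffun k => (t k, Stay)])
  | inl (Some s) =>
      let: (o, a) := fbody s t in
      (inr (o, omap (fun a => [ffun k => a k]) a),
       [ffun k => phase1 (if a is Some a then a k else inr false) (t k)])
  | inr (o, Some a) => (inl o, [ffun k => phase2 (a k) (t k)])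
  | inr (o, None) => (q, [ffun k => (t k, Stay)])
  end.

Definition tm : oracleTM :=
  @OracleTM tm_state Gamma wk (inl (Some (fstart F)))
    (fun q => q == inl None) tm_ask tm_delta.

Lemma nonblank_scanned (t : tape Gamma) : scanned t = ohead (nonblank t.2).
Proof. by case: t => l [|[a|] r]. Qed.

Lemma leading_bits_nonblank s : leading_bits s = lead_inl (nonblank s).
Proof. by elim: s => [//|[[b|c]|] s IH] //=; rewrite IH. Qed.

Lemma nonblank_phases (a : action) (t : tape Gamma) :
  let p := phase1 a (scanned t) in
  let t' := Defs.shift p.2 (write p.1 t) in
  let p' := phase2 a (scanned t') in
  nonblank (Defs.shift p'.2 (write p'.1 t')).2 = act a (nonblank t.2).
Proof.
by case: t => l [|[x|] r]; case: a => [[y|]|[]]; case: l => //=;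
  case: r => //= -[?|] ?.
Qed.

Definition tm_sim (c : config tm) (d : fconfig F) : Prop :=
  c.1 = inl d.1 /\ forall k, nonblank (c.2 k).2 = d.2 k.

Lemma tm_sim_step c d : tm_sim c d ->
  exists2 n : nat, (n <= 2)%N & tm_sim (iter n (step g) c) (fstep d).
Proof.
case: c d => q T [[s|] st] [/= -> ET]; last by exists 0%N.
exists 2%N => //; rewrite /tm_sim /fstep /=.
have Etops : tops st = [ffun i => scanned (T i)].
  by apply/funext => k; rewrite ffunE nonblank_scanned ET.
rewrite Etops; case: (fbody s _) => o [a|] /=; split=> //= k; rewrite !ffunE.
  by rewrite -ET -nonblank_phases.
case: ifP => // _; case: ifP => _.
  rewrite /tape_word leading_bits_nonblank /= -ET /write.
  have /= -> : nonblank (scanned (T (inl Query)) :: behead (T (inl Query)).2) =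
            nonblank (T (inl Query)).2.
    by case: (T _) => l [].
  by elim: (g _) => //= ? ? ->.
by rewrite -ET /=; case: (T k) => l [].
Qed.

Lemma tm_sim_iter n c d : tm_sim c d ->
  exists2 m : nat, (m <= n.*2)%N & tm_sim (iter m (step g) c) (iter n (@fstep F) d).
Proof.
elim: n c d => [|n IH] c d sim_cd; first by exists 0%N.
have [m le_m sim'] := tm_sim_step sim_cd.
have [m' le_m' sim''] := IH _ _ sim'.
exists (m' + m)%N; first by rewrite doubleS; lia.
by rewrite iterD iterSr.
Qed.

End Compile.

Definition input_store (x : word) : store :=
  fun k => if k == inl Input then map inl x else [::].

Lemma oracle_polytime_frag (F : frag) (f : word -> word) (c e : nat) :
  (forall x, exists n s', [/\ (n <= c * size x ^ e + c)%N,
     runs F (input_store x) n s' & lead_inl (s' (inl Output)) = f x]) ->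
  oracle_polytime g f.
Proof.
move=> H; exists (tm F), c.*2, e => x.
have [n [s' [le_n run <-]]] := H x.
have sim0 : tm_sim (init (tm F) x) (Some (fstart F), input_store x).
  split=> // k; rewrite /init ffunE /input_store /=.
  change (if k == inl Input :> port + wk then word_tape x else blank_tape)
    with ((fun k' : port + wk => if k' == inl Input then @word_tape Gamma x
             else blank_tape) k) => /=; case: eqP => // _.
  by elim: x {H le_n run} => //= b x ->.
have [m le_m] := tm_sim_iter n sim0.
rewrite run => -[Eq ET]; exists m; split.
- by apply: (leq_trans le_m); rewrite -!muln2; nia.
- by rewrite Eq.
- by rewrite /tape_word leading_bits_nonblank ET.
Qed.

(** ** Combinators *)

Definition fop (a : (K -> option A) -> K -> action) : frag :=
  @Frag unit tt (fun _ t => (None, Some (a t))).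

Lemma runs_fop a s s' :
  exec (Some (a (tops s))) s = s' -> runs (fop a) s 1 s'.
Proof. by move=> <-. Qed.

Definition fseq (F1 F2 : frag) : frag :=
  @Frag (fstate F1 + fstate F2)%type (inl (fstart F1))
    (fun q t => match q with
     | inl q => let: (o, a) := fbody q t in
                (Some (if o is Some q' then inl q' else inr (fstart F2)), a)
     | inr q => let: (o, a) := fbody q t in (omap inr o, a)
     end).

(** The common part of the proofs for all combinators: a copy of [F] inside [G] behaves like [F]
    until the exit, which is redirected to [e]. The count drops to [m] because the [n] steps may
    include idle ones after the exit. *)
Lemma iter_embed (F G : frag) (j : fstate F -> fstate G)
    (e : option (fstate G)) :
  (forall q s, fstep (Some (j q), s) =
     let: (o, s') := fstep (Some q, s) in (if o is Some q' then Some (j q') else e, s')) ->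
  forall n q s s', iter n (@fstep F) (Some q, s) = (None, s') ->
  exists2 m, (m <= n)%N &
    iter m (@fstep G) (Some (j q), s) = (e, s').
Proof.
move=> Hj; elim=> [//|n IH] q s s'; rewrite iterSr.
case: (@fstep F (Some q, s)) (Hj q s) => -[q'|] s1 E1 E2.
  have [m le_m Em] := IH _ _ _ E2.
  by exists m.+1 => //; rewrite iterSr E1.
by move: E2; rewrite iter_fstep_None => -[<-]; exists 1%N; rewrite //= E1.
Qed.

Lemma runs_fseq F1 F2 s s1 s2 n1 n2 :
  runs F1 s n1 s1 -> runs F2 s1 n2 s2 -> runs (fseq F1 F2) s (n1 + n2) s2.
Proof.
move=> R1 R2.
have [|m1 le1 E1] := @iter_embed F1 (fseq F1 F2) inl
    (Some (inr (fstart F2))) _ _ _ _ _ R1.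
  by move=> q t; rewrite /fstep /=; case: (fbody _ _) => -[].
have [|m2 le2 E2] := @iter_embed F2 (fseq F1 F2) inr None _ _ _ _ _ R2.
  by move=> q t; rewrite /fstep /=; case: (fbody _ _) => -[].
apply: (@runs_le _ _ (m2 + m1)); last by lia.
by rewrite /runs iterD E1.
Qed.

Definition fif (p : (K -> option A) -> bool) (F1 F2 : frag) : frag :=
  @Frag (unit + (fstate F1 + fstate F2))%type (inl tt)
    (fun q t => match q with
     | inl _ => (Some (inr (if p t then inl (fstart F1) else inr (fstart F2))),
                 Some (fun=> inr false))
     | inr (inl q) => let: (o, a) := fbody q t in (omap (inr \o inl) o, a)
     | inr (inr q) => let: (o, a) := fbody q t in (omap (inr \o inr) o, a)
     end).

Lemma runs_fif (p : (K -> option A) -> bool) F1 F2 s s' n :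
  (if p (tops s) then runs F1 s n s' else runs F2 s n s') ->
  runs (fif p F1 F2) s n.+1 s'.
Proof.
move=> R; rewrite /runs iterSr /fstep /= -/(@fstep (fif p F1 F2)).
case: (p _) R => R.
  have [|m le_m E] := @iter_embed F1 (fif p F1 F2) (inr \o inl) None _ _ _ _ _ R.
    by move=> q t; rewrite /fstep /=; case: (fbody _ _) => -[].
  by rewrite -(subnK le_m) iterD E iter_fstep_None.
have [|m le_m E] := @iter_embed F2 (fif p F1 F2) (inr \o inr) None _ _ _ _ _ R.
  by move=> q t; rewrite /fstep /=; case: (fbody _ _) => -[].
by rewrite -(subnK le_m) iterD E iter_fstep_None.
Qed.

Definition fwhile (p : (K -> option A) -> bool) (F : frag) : frag :=
  @Frag (unit + fstate F)%type (inl tt)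
    (fun q t => match q with
     | inl _ => (if p t then Some (inr (fstart F)) else None,
                 Some (fun=> inr false))
     | inr q => let: (o, a) := fbody q t in
                (Some (if o is Some q' then inr q' else inl tt), a)
     end).

Lemma runs_fwhile_false p F s : ~~ p (tops s) -> runs (fwhile p F) s 1 s.
Proof. by rewrite /runs /fstep /= => /negbTE ->. Qed.

Lemma runs_fwhile_true (p : (K -> option A) -> bool) F s n1 s1 n2 s2 :
  p (tops s) -> runs F s n1 s1 -> runs (fwhile p F) s1 n2 s2 ->
  runs (fwhile p F) s (n1 + n2).+1 s2.
Proof.
move=> ps R1 R2; have [|m le_m E] := @iter_embed F (fwhile p F) inr
    (Some (inl tt)) _ _ _ _ _ R1.
  by move=> q t; rewrite /fstep /=; case: (fbody _ _) => -[].
apply: (@runs_le _ _ (n2 + m.+1)); last by lia.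
have E0 : @fstep (fwhile p F) (Some (inl tt), s) = (Some (inr (fstart F)), s).
  by rewrite /fstep /= ps.
by rewrite /runs iterD iterSr E0 E.
Qed.

End StackMachine.

Local Arguments exec : simpl never.

(** * Calling a machine from a stack machine *)

(** The increment 2 is reached on an empty right part: writing creates a cell and a move to the left
    adds another. The answer tape is excluded, since one query can make it arbitrarily long. *)
Lemma step_right_size (M : oracleTM) (g : word -> word) (c : config M) i :
  i != inl Answer ->
  (size ((step g c).2 i).2 <= size (c.2 i).2 + 2)%N.
Proof.
case: c => q T /= nA; rewrite /step.
case: ifP => _ /=; first by lia.
case: ask => [q'|] /=.
  by rewrite ffunE (negbTE nA); case: ifP => //= _; lia.
case: (delta _ _) => q' a /=; rewrite ffunE.
by case: (T i) => l r; case: (a i) => x [] /=; rewrite size_behead; lia.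
Qed.

(** A step adds at most two cells to the output tape. This bounds the words that a call returns. *)
Lemma outputs_within_size (M : oracleTM) (g : word -> word) x y n :
  @outputs_within M g x y n -> (size y <= n.*2)%N.
Proof.
move=> [t [le_tn _ <-]]; apply: (@leq_trans t.*2); last by rewrite leq_double.
have le_lead (s : seq (symbol (extra M))) : (size (leading_bits s) <= size s)%N.
  by elim: s => [|[[]|] s IH].
apply: leq_trans (le_lead _) _; elim: t {le_tn} => [|t IH] /=.
  by rewrite ffunE.
by apply: leq_trans (step_right_size _ _ _) _ => //; lia.
Qed.

Section Call.

Variables (Gamma wk : finType) (g : word -> word).
Local Notation K := (port + wk)%type.
Local Notation A := (bool + Gamma)%type.

Definition bstore := K -> word.

Definition emb (m : bstore) : store Gamma wk := fun k => map inl (m k).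

Definition upd (m : bstore) (k : K) (v : word) : bstore :=
  fun k' => if k' == k then v else m k'.

Variable M : oracleTM.
Local Notation tapes := (port + work M)%type.
(** The blank of [M] gets a stack symbol of its own, since a blank inside a tape must not end the
    stack; an empty stack is again read as a blank. Bits encode themselves, so queries and answers
    need no translation. *)
Variables (enc : symbol (extra M) -> A) (dec : option A -> symbol (extra M)).
Hypothesis dec0 : dec None = None.
Hypothesis encK : forall x, dec (Some (enc x)) = x.
Hypothesis enc_bit : forall b, enc (Some (inl b)) = inl b.

(* [kap (i, true)] carries the part of the tape [i] of [M] from its head
   rightwards, and [kap (i, false)] the part to the left of the head. An answer
   may be too long to be copied, so the right parts of the query and answer
   tapes must be the ports themselves. *)
Variable kap : tapes * bool -> K.
Hypothesis kap_inj : injective kap.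
Hypothesis kapQ : kap (inl Query, true) = inl Query.
Hypothesis kapA : kap (inl Answer, true) = inl Answer.

Definition rho (k : K) : option (tapes * bool) := [pick p | kap p == k].

Lemma rhoK p : rho (kap p) = Some p.
Proof.
by rewrite /rho; case: pickP => [p' /eqP/kap_inj->|/(_ p)]; rewrite ?eqxx.
Qed.

Lemma rho_Some k p : rho k = Some p -> k = kap p.
Proof. by rewrite /rho; case: pickP => // p' /eqP <- [->]. Qed.

Definition half (T : tape (extra M)) (b : bool) := if b then T.2 else T.1.

Definition encode (T : tapes -> tape (extra M)) (s : store Gamma wk) :
    store Gamma wk :=
  fun k => if rho k is Some (i, b) then map enc (half (T i) b) else s k.

Lemma encode_kap T s i b : encode T s (kap (i, b)) = map enc (half (T i) b).
Proof. by rewrite /encode rhoK. Qed.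

Lemma lead_inl_enc r : lead_inl (map enc r) = leading_bits r.
Proof.
elim: r => [//|x r IH] /=.
case E: (enc x) => [b|c].
  suff -> : x = Some (inl b) by rewrite IH.
  by rewrite -(encK x) E -enc_bit encK.
by case: x E => [[b|//]|//]; rewrite enc_bit.
Qed.

(** An ordinary step of [M] becomes three: pop the scanned symbols; push the written ones, onto the
    left stack if the head moves right; for a move to the left, transfer the top of the left stack.
    The symbols read are kept in the state. A query becomes two: the query itself, then the emptying
    of the left halves of the query and answer tapes. *)
Definition callstate : finType :=
  ((bool * state M) + bool * (state M * {ffun tapes -> symbol (extra M)}))%type.

Definition on_tapes (a : tapes -> bool -> action Gamma) (k : K) : action Gamma :=
  if rho k is Some (i, b) then a i b else inr false.

Lemma act_on_tapes a (T T' : tapes -> tape (extra M)) s :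
  (forall i b, act (a i b) (map enc (half (T i) b)) = map enc (half (T' i) b)) ->
  exec g (Some (on_tapes a)) (encode T s) = encode T' s.
Proof.
move=> H; apply/funext => k; rewrite /exec /encode /on_tapes.
by case: (rho k) => [[i b]|].
Qed.

Definition callbody (q : callstate) (t : K -> option A) :
    option callstate * option (K -> action Gamma) :=
  match q with
  | inl (false, q) =>
      if halted q then (None, Some (fun=> inr false)) else
      if ask q is Some q' then (Some (inl (true, q')), None) else
      (Some (inr (false, (q, [ffun i => dec (t (kap (i, true)))]))),
       Some (on_tapes (fun i b => inr b)))
  | inl (true, q) =>
      (Some (inl (false, q)),
       Some (on_tapes (fun i b =>
         if (i \in [:: inl Query; inl Answer]) && ~~ b then inl None
         else inr false)))
  | inr (false, (q, s)) =>
      (Some (inr (true, (q, s))),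
       Some (on_tapes (fun i b =>
         let: (x, v) := (delta q s).2 i in
         if (if v is MoveRight then ~~ b else b) then inl (Some (enc x))
         else inr false)))
  | inr (true, (q, s)) =>
      (Some (inl (false, (delta q s).1)),
       Some (on_tapes (fun i b =>
         if ((delta q s).2 i).2 is MoveLeft then
           if b then inl (Some (enc (dec (t (kap (i, false)))))) else inr true
         else inr false)))
  end.

Definition fsim : frag Gamma wk := Frag (inl (false, start M) : callstate) callbody.

Lemma fsim_step q (T : {ffun tapes -> tape (extra M)}) s : ~~ halted q ->
  exists2 n, (n <= 3)%N &
    iter n (@fstep _ _ g fsim) (Some (inl (false, q)), encode T s) =
    (Some (inl (false, (step g (q, T)).1)), encode (step g (q, T)).2 s).
Proof.
move=> /negbTE nh; rewrite /step nh.
case E: (ask q) => [q'|].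
  exists 2%N => //; rewrite /= /fstep /= nh E.
  set s1 := exec _ None _.
  congr (_, _); apply/funext => k; rewrite /exec /on_tapes /encode.
  case Ek: (rho k) => [[i b]|]; last first.
    rewrite /s1 /= /exec.
    case: eqP => [k0|_]; first by move: Ek; rewrite k0 -kapQ rhoK.
    case: eqP => [k0|_]; first by move: Ek; rewrite k0 -kapA rhoK.
    by rewrite /encode Ek.
  rewrite (rho_Some Ek) /s1 /exec -kapQ -kapA /= !(inj_eq kap_inj) !encode_kap.
  rewrite !xpair_eqE !ffunE !inE lead_inl_enc.
  case: (i =P inl Query) => [_|_] /=; first by case: b {Ek}.
  case: (i =P inl Answer) => [_|_] /=; last by [].
  case: b {Ek} => //=; rewrite -map_comp.
  by apply: eq_map => ? /=; rewrite enc_bit.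
exists 3%N => //=; rewrite {3}/fstep /= nh E.
set u := [ffun i => _].
have Eu : u = [ffun i => scanned (T i)].
  apply/ffunP => i; rewrite !ffunE /tops encode_kap /scanned /=.
  by case: (T i).2 => //= a r; rewrite encK.
rewrite {u}Eu; set u := [ffun i => _].
case Ed: (delta q u) => [q' a] /=.
pose T1 i := ((T i).1, behead (T i).2).
rewrite (@act_on_tapes _ _ T1); last by move=> i []; rewrite //= /T1 /= behead_map.
pose T2 i := if (a i).2 is MoveRight then ((a i).1 :: (T i).1, behead (T i).2)
             else ((T i).1, (a i).1 :: behead (T i).2).
rewrite {2}/fstep /= Ed (@act_on_tapes _ _ T2); last first.
  by move=> i b; rewrite /T1 /T2; case: (a i) => x [] /=; case: b.
rewrite /fstep /= Ed.
congr (_, _); apply: act_on_tapes => i b; rewrite ffunE /T2 /tops encode_kap /T2.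
case: (T i) => l r; case: (a i) => x [] /=; case: b => //=.
- by case: l => [|y l] /=; rewrite ?dec0 ?encK.
- by rewrite behead_map.
Qed.

Lemma fsim_runs t q (T : {ffun tapes -> tape (extra M)}) s :
  halted (iter t (step g) (q, T)).1 ->
  exists2 n, (n <= 3 * t + 1)%N &
    iter n (@fstep _ _ g fsim) (Some (inl (false, q)), encode T s) =
    (None, encode (iter t (step g) (q, T)).2 s).
Proof.
have halt q' T' : halted q' ->
    iter 1 (@fstep _ _ g fsim) (Some (inl (false, q')), encode T' s) =
    (None, encode T' s).
  by move=> h; rewrite /= /fstep /= h.
elim: t q T => [|t IH] q T /=.
  by move=> h; exists 1%N => //; apply: halt.
rewrite -iterS iterSr => h.
have [hq|nh] := boolP (halted q).
  exists 1%N; first by lia.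
  have Es : step g (q, T) = (q, T) by rewrite /step hq.
  have Et : iter t (step g) (q, T) = (q, T).
    by elim: t {IH h} => //= t ->; rewrite Es.
  by rewrite halt // Es Et.
have [n le_n En] := fsim_step T s nh.
move: h En; case: (step g (q, T)) => q1 T1 h En.
have [n' le_n' En'] := IH _ _ h.
by exists (n' + n)%N; [lia | rewrite iterD En].
Qed.

Variable O : K.
Hypothesis rhoO : rho O = None.

Definition fout : frag Gamma wk :=
  fwhile (fun t => if t (kap (inl Output, true)) is Some (inl _) then true else false)
    (fop (fun t k => if k == O then inl (t (kap (inl Output, true)))
                     else inr (k == kap (inl Output, true)))).

(** One step restores all stacks of the call to empty, however long the last oracle answer is. *)
Definition fclear : frag Gamma wk :=
  fop (fun _ k => if rho k is Some _ then inl None else inr false).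

Definition fcall : frag Gamma wk := fseq fsim (fseq fout fclear).

Lemma O_kap p : (O == kap p) = false.
Proof. by apply/negP => /eqP EO; move: rhoO; rewrite EO rhoK. Qed.

Lemma fout_runs s y : y = lead_inl (s (kap (inl Output, true))) ->
  runs g fout s (2 * size y + 1)
    (fun k => if k == O then rev (map inl y) ++ s O
              else if k == kap (inl Output, true)
                   then drop (size y) (s (kap (inl Output, true))) else s k).
Proof.
elim: y s => [|b y IH] s Ey.
  rewrite (_ : (fun k => _) = s).
    by apply: runs_fwhile_false; rewrite /tops; case: (s _) Ey => [|[]].
  apply/funext => k; case: eqP => [->|_] //; case: eqP => [->|_] //.
  by rewrite drop0.
case Es: (s _) Ey => [//|[c|//] r] /= [Ebc Ey].
move: Es; rewrite -Ebc => Es.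
rewrite (_ : _ + 1 = (1 + (2 * size y + 1)).+1)%N; last by rewrite /=; lia.
apply: (runs_fwhile_true _ (runs_fop (erefl _))); first by rewrite /tops Es.
set s1 := exec _ _ _.
have E1 : s1 (kap (inl Output, true)) = r.
  by rewrite /s1 /exec eq_sym O_kap eqxx /= Es.
have EO : s1 O = inl b :: s O by rewrite /s1 /exec eqxx /= /tops Es.
have := IH s1; rewrite E1 => /(_ Ey); congr (runs _ _ _ _ _).
apply/funext => k; case: eqP => kO.
  by rewrite EO /= rev_cons cat_rcons.
by case: eqP => kk //; rewrite /s1 /exec; case: eqP => // _; case: eqP.
Qed.

(** The result arrives reversed, as it is moved from stack to stack. The time is [3 n + 1] for the
    simulation, [4 n + 1] for moving at most [2 n] bits, and one step for clearing. *)
Theorem fcall_runs (m : bstore) x y n :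
  m (kap (inl Input, true)) = x ->
  (forall p, p != (inl Input, true) -> m (kap p) = [::]) ->
  @outputs_within M g x y n ->
  runs g fcall (emb m) (7 * n + 3)
    (emb (upd (upd m (kap (inl Input, true)) [::]) O (rev y ++ m O))).
Proof.
move=> mI m0 out; have le_y := outputs_within_size out.
have [t [le_tn h Ey]] := out.
have Em : emb m = encode (init M x).2 (emb m).
  apply/funext => k; rewrite /encode; case Ek: (rho k) => [[i b]|] //.
  rewrite (rho_Some Ek) /emb /init /= ffunE.
  case: eqP => [-> |ni] /=.
    case: b {Ek}; last by rewrite m0.
    by rewrite mI -map_comp; apply: eq_map => c /=; rewrite enc_bit.
  by rewrite m0; [case: b {Ek} | rewrite xpair_eqE; case: eqP].
have [n1 le_n1 R1] := fsim_runs (emb m) h.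
rewrite -/(init M x) in R1; set T := (iter _ _ _).2 in R1 Ey.
apply: (@runs_le _ _ _ _ _ (n1 + ((2 * size y + 1) + 1))); last by lia.
apply: (@runs_fseq _ _ _ _ _ _ (encode T (emb m))); first by rewrite /runs {1}Em.
have Rout : y = lead_inl (encode T (emb m) (kap (inl Output, true))).
  by rewrite encode_kap /= lead_inl_enc.
apply: (runs_fseq (fout_runs Rout)).
apply: runs_fop.
apply/funext => k; rewrite /emb /upd /exec.
case: (k =P O) => [->|kO]; first by rewrite rhoO /= /encode rhoO map_cat map_rev.
case: (k =P kap (inl Input, true)) => [->|kI]; first by rewrite rhoK.
case Ek: (rho k) => [p|].
  rewrite (rho_Some Ek) m0 //; apply: contra_notN kI => /eqP <-.
  exact: rho_Some.
case: (k =P kap (inl Output, true)) => [kk|_ /=]; first by move: Ek; rewrite kk rhoK.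
by rewrite /encode Ek.
Qed.

End Call.

(** * Programs on stacks of bits *)

Fixpoint incc (c : bool) (y : word) : word :=
  if y is b :: y' then (c (+) b) :: incc (c && b) y'
  else if c then [:: true] else [::].

(* Addition with carry of numerals whose least significant bit comes first *)
Fixpoint addc (c : bool) (x y : word) : word :=
  match x, y with
  | [::], _ => incc c y
  | _, [::] => incc c x
  | a :: x', b :: y' =>
      (a (+) b (+) c) :: addc [|| a && b, a && c | b && c] x' y'
  end.

Fixpoint lsb_val (x : word) : nat := if x is b :: x' then (b + (lsb_val x').*2)%N else 0.

Lemma lsb_val_incc c y : lsb_val (incc c y) = (c + lsb_val y)%N.
Proof. by elim: y c => [|b y IH] [] //=; rewrite IH; case: b => /=; lia. Qed.

Lemma lsb_val_addc c x y : lsb_val (addc c x y) = (c + lsb_val x + lsb_val y)%N.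
Proof.
elim: x c y => [|a x IH] c y; first by rewrite addn0 -lsb_val_incc; case: y.
case: y => [|b y]; first by rewrite addn0 -lsb_val_incc.
by rewrite /= IH; case: a; case: b; case: c => /=; lia.
Qed.

Lemma size_incc c y : (size (incc c y) <= size y + c)%N.
Proof.
elim: y c => [|b y IH] c /=; first by case: c.
by have := IH (c && b); case: c; case: b => /=; lia.
Qed.

Lemma size_addc c x y : (size (addc c x y) <= (maxn (size x) (size y)).+1)%N.
Proof.
elim: x c y => [|a x IH] c y; have := leq_b1 c.
  have -> : addc c [::] y = incc c y by case: y.
  by have := size_incc c y; rewrite max0n; lia.
case: y => [|b y].
  rewrite [addc _ _ _]/(incc c (a :: x)) maxn0.
  by have := size_incc c (a :: x) => le1 le2; apply: leq_trans le1 _; rewrite -addn1 leq_add2l.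
by have := IH [|| a && b, a && c | b && c] y; rewrite /=; lia.
Qed.

(** Multiplication is done by repeated addition. One more bit per addition is a crude bound, but the
    multipliers [L + 1] are small enough for it to stay polynomial. *)
Lemma size_iter_addc x n : (size (iter n (addc false x) [::]) <= size x + n)%N.
Proof.
elim: n => [//|n IH] /=.
by have := size_addc false x (iter n (addc false x) [::]); lia.
Qed.

Lemma lsb_val_iter_addc x n : lsb_val (iter n (addc false x) [::]) = (n * lsb_val x)%N.
Proof. by elim: n => //= n IH; rewrite lsb_val_addc IH; lia. Qed.

Lemma rev_succ_true i x : rev_succ (nseq i true ++ x) = nseq i false ++ rev_succ x.
Proof. by elim: i => //= i ->. Qed.

(** The initial ones are the bits that the successor turns into zeros. *)
Lemma split_true x : exists i y, x = nseq i true ++ y /\ ohead y <> Some true.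
Proof.
elim: x => [|[] x [i [y [-> Hy]]]]; first by exists 0%N, [::].
  by exists i.+1, y.
by exists 0%N, (false :: nseq i true ++ y).
Qed.

Lemma upd_same wk (m : bstore wk) k v : upd m k v k = v.
Proof. by rewrite /upd eqxx. Qed.

Lemma upd_neq wk (m : bstore wk) k v k' : k' <> k -> upd m k v k' = m k'.
Proof. by rewrite /upd; case: eqP. Qed.

Ltac look := repeat match goal with
  |- context [upd ?m ?k ?v ?k'] =>
    first [rewrite (@upd_same _ m k v)
          | rewrite (@upd_neq _ m k v k'); [|congruence]]
  end.

Ltac sto_close := solve [by [] | congruence | rewrite /=; congruence].

Ltac sto := let k := fresh "k" in
  apply/funext => k; look;
  repeat match goal with
  |- context [upd ?m ?r ?v k] =>
    let E := fresh in case: (k =P r) => [E|E]; [rewrite E; look; sto_close|look]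
  end; sto_close.

Section BitPrograms.

Variables (Gamma wk : finType) (g : word -> word).
Local Notation K := (port + wk)%type.
Local Notation A := (bool + Gamma)%type.
Local Notation bstore := (bstore wk).
Implicit Types (m : bstore) (k : K).

Inductive baction := Pop | Push of bool | Clear.

Definition baction_act (a : baction) : action Gamma :=
  match a with Pop => inr true | Push b => inl (Some (inl b)) | Clear => inl None end.

Definition bact (a : baction) (x : word) : word :=
  match a with Pop => behead x | Push b => b :: x | Clear => [::] end.

Definition btops (m : bstore) (k : K) : option bool := ohead (m k).

Definition untop (t : K -> option A) (k : K) : option bool :=
  if t k is Some (inl b) then Some b else None.

Definition bruns (P : frag Gamma wk) m n m' := runs g P (@emb Gamma wk m) n (@emb Gamma wk m').

Fixpoint lookup (l : seq (K * baction)) (k : K) : action Gamma :=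
  if l is (k', a) :: l' then if k == k' then baction_act a else lookup l' k
  else inr false.

Definition bop (a : (K -> option bool) -> seq (K * baction)) : frag Gamma wk :=
  fop (fun t => lookup (a (untop t))).

Definition bif (p : (K -> option bool) -> bool) := @fif Gamma wk (fun t => p (untop t)).

Definition bwhile (p : (K -> option bool) -> bool) := @fwhile Gamma wk (fun t => p (untop t)).

Lemma untop_emb m : untop (tops (@emb Gamma wk m)) = btops m.
Proof. by apply/funext => k; rewrite /untop /tops /emb /btops; case: (m k). Qed.

Lemma bruns_le P m n n' m' : bruns P m n m' -> (n <= n')%N -> bruns P m n' m'.
Proof. exact: runs_le. Qed.

Lemma bruns_seq P Q m n1 m1 n2 m2 :
  bruns P m n1 m1 -> bruns Q m1 n2 m2 -> bruns (fseq P Q) m (n1 + n2) m2.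
Proof. exact: runs_fseq. Qed.

(** All actions apply to the original store and [lookup] takes the first entry for a stack; for
    distinct stacks this agrees with successive updates. *)
Lemma bruns_op a m (l := a (btops m)) :
  uniq (map fst l) ->
  bruns (bop a) m 1 (foldr (fun p m' => upd m' p.1 (bact p.2 (m p.1))) m l).
Proof.
move=> Ul; apply: runs_fop; rewrite untop_emb -/l.
apply/funext => k; rewrite /exec /emb.
elim: l Ul => [//|[k' a'] l IH] /= /andP[k'l Ul]; rewrite /upd.
case: eqP => [->|_]; last exact: IH.
by case: a' => //=; case: (m k').
Qed.

Lemma bruns_if p P Q m n m' :
  (if p (btops m) then bruns P m n m' else bruns Q m n m') ->
  bruns (bif p P Q) m n.+1 m'.
Proof. by move=> H; apply: runs_fif; rewrite untop_emb. Qed.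

Lemma bruns_while_false p P m : ~~ p (btops m) -> bruns (bwhile p P) m 1 m.
Proof. by move=> H; apply: runs_fwhile_false; rewrite untop_emb. Qed.

Lemma bruns_while_true (p : (K -> option bool) -> bool) P m n1 m1 n2 m2 :
  p (btops m) -> bruns P m n1 m1 -> bruns (bwhile p P) m1 n2 m2 ->
  bruns (bwhile p P) m (n1 + n2).+1 m2.
Proof. by move=> H; apply: runs_fwhile_true; rewrite untop_emb. Qed.

Definition nonempty (k : K) (t : K -> option bool) : bool := t k != None.

Definition push k b := bop (fun=> [:: (k, Push b)]).
Definition clear k := bop (fun=> [:: (k, Clear)]).

Lemma push_runs k b m : bruns (push k b) m 1 (upd m k (b :: m k)).
Proof. exact: (@bruns_op (fun=> _)). Qed.

Lemma clear_runs k m : bruns (clear k) m 1 (upd m k [::]).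
Proof. exact: (@bruns_op (fun=> _)). Qed.

Lemma bruns_eq P m n m' m'' : bruns P m n m' -> m' = m'' -> bruns P m n m''.
Proof. by move=> H <-. Qed.

(* [S u v] is the store when the part [u] of the loop counter [r] has been
   consumed and [v] is left. *)
Lemma bruns_while_pop r (P : frag Gamma wk) (S : word -> word -> bstore) c x :
  (forall u v, S u v r = v) ->
  (forall u b v, x = u ++ b :: v ->
     bruns P (S u (b :: v)) c (S (rcons u b) v)) ->
  bruns (bwhile (nonempty r) P) (S [::] x) (size x * c.+1 + 1) (S x [::]).
Proof.
move=> Sr HP.
suff H v u : x = u ++ v ->
    bruns (bwhile (nonempty r) P) (S u v) (size v * c.+1 + 1) (S x [::]) by exact: H.
elim: v u => [|b v IH] u Ex.
  by rewrite Ex cats0; apply: bruns_while_false; rewrite /nonempty /btops Sr.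
rewrite (_ : _ + 1 = (c + (size v * c.+1 + 1)).+1)%N; last by rewrite /=; lia.
apply: bruns_while_true (HP _ _ _ Ex) _; first by rewrite /nonempty /btops Sr.
by apply: IH; rewrite Ex cat_rcons.
Qed.

(** * Copying, successor and addition on stacks *)

Definition pour a b := bwhile (nonempty a)
  (bop (fun t => [:: (a, Pop); (b, Push (t a == Some true))])).

Definition pour2 a b c := bwhile (nonempty a)
  (bop (fun t => [:: (a, Pop); (b, Push (t a == Some true)); (c, Push (t a == Some true))])).

Lemma pour_runs a b m : a <> b ->
  bruns (pour a b) m (2 * size (m a) + 1) (upd (upd m a [::]) b (rev (m a) ++ m b)).
Proof.
move=> ab; pose S u v := upd (upd m a v) b (rev u ++ m b).
have Em : m = S [::] (m a) by rewrite /S; sto.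
rewrite {1}Em mulnC; apply: (@bruns_while_pop a _ S) => [u v|u c v E].
  by rewrite /S; look.
apply: bruns_eq; first apply: bruns_op.
  by rewrite /= inE andbT; apply/eqP.
rewrite /S /btops /= rev_rcons; look; rewrite /= (_ : (_ == _) = c); last by case: c {E}.
by sto.
Qed.

Lemma pour2_runs a b c m : a <> b -> a <> c -> b <> c ->
  bruns (pour2 a b c) m (2 * size (m a) + 1)
    (upd (upd (upd m a [::]) b (rev (m a) ++ m b)) c (rev (m a) ++ m c)).
Proof.
move=> ab ac bc.
pose S u v := upd (upd (upd m a v) b (rev u ++ m b)) c (rev u ++ m c).
have Em : m = S [::] (m a) by rewrite /S; sto.
rewrite {1}Em mulnC; apply: (@bruns_while_pop a _ S) => [u v|u d v E].
  by rewrite /S; look.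
apply: bruns_eq; first apply: bruns_op.
  by rewrite /= !inE andbT negb_or; apply/andP; split; [apply/andP; split|]; apply/eqP.
rewrite /S /btops /= rev_rcons; look; rewrite /= (_ : (_ == _) = d); last by case: d {E}.
by sto.
Qed.

(* [t] is a scratch stack in the following programs. *)
Definition copy a b t := fseq (pour a t) (pour2 t a b).

Lemma copy_runs a b t m : a <> b -> a <> t -> b <> t -> m t = [::] ->
  bruns (copy a b t) m (4 * size (m a) + 2) (upd m b (m a ++ m b)).
Proof.
move=> ab a_t bt mt.
apply: bruns_eq; first apply: bruns_le.
- by apply: bruns_seq; [apply: pour_runs | apply: pour2_runs; congruence].
- by look; rewrite size_cat size_rev mt /=; lia.
- by look; rewrite mt !(cats0, revK); sto.
Qed.

Definition revcopy a b t := fseq (pour2 a b t) (pour t a).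

Lemma revcopy_runs a b t m : a <> b -> a <> t -> b <> t -> m t = [::] ->
  bruns (revcopy a b t) m (4 * size (m a) + 2) (upd m b (rev (m a) ++ m b)).
Proof.
move=> ab a_t bt mt.
apply: bruns_eq; first apply: bruns_le.
- by apply: bruns_seq; [apply: pour2_runs | apply: pour_runs; congruence].
- by look; rewrite size_cat size_rev mt /=; lia.
- by look; rewrite mt !(cats0, revK); sto.
Qed.

Definition pop k := bop (fun=> [:: (k, Pop)]).

Lemma pop_runs k m : bruns (pop k) m 1 (upd m k (behead (m k))).
Proof. exact: (@bruns_op (fun=> _)). Qed.

Definition succ x t :=
  fseq (bwhile (fun s => s x == Some true)
         (bop (fun=> [:: (x, Pop); (t, Push false)])))
  (fseq (bif (fun s => s x == Some false)
             (fseq (pop x) (push x true)) (push x false))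
        (pour t x)).

Lemma succ_runs x t m : x <> t -> m t = [::] ->
  bruns (succ x t) m (4 * size (m x) + 6) (upd m x (rev_succ (m x))).
Proof.
move=> xt mt; have [i [y [Ex Hy]]] := split_true (m x).
have loop j m' : m' x = nseq j true ++ y ->
    bruns (bwhile (fun s => s x == Some true)
             (bop (fun=> [:: (x, Pop); (t, Push false)]))) m' (2 * j + 1)
          (upd (upd m' x y) t (nseq j false ++ m' t)).
  elim: j m' => [|j IH] m' E.
    apply: bruns_eq; first by apply: bruns_while_false; rewrite /btops E; apply/eqP.
    by rewrite /= in E; sto.
  rewrite (_ : _ + 1 = (1 + (2 * j + 1)).+1)%N; last by lia.
  apply: bruns_eq; first apply: bruns_while_true; first by rewrite /btops E.
  - by apply: (@bruns_op (fun=> _)); rewrite /= inE andbT; apply/eqP.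
  - by apply: IH => /=; look; rewrite E.
  - rewrite /=; look.
    have -> : nseq j false ++ false :: m' t = false :: nseq j false ++ m' t.
      by elim: j {IH E} => //= j ->.
    by sto.
rewrite Ex rev_succ_true size_cat size_nseq.
apply: bruns_eq; first apply: bruns_le.
- apply: bruns_seq; first exact: loop Ex.
  apply: bruns_seq; last by apply: pour_runs; congruence.
  apply: (@bruns_if _ _ _ _ 2 (upd (upd m x (rev_succ y)) t (nseq i false))).
  rewrite /btops mt cats0; look; case: eqP => [Ey|Ey].
    apply: bruns_eq; first apply: bruns_le.
    - by apply: bruns_seq; [apply: pop_runs | apply: push_runs].
    - by [].
    by look; case: y Hy Ey {Ex loop} => [//|[] y] // _ _; sto.
  apply: bruns_eq; first by apply: bruns_le; first apply: push_runs.
  by look; case: y Hy Ey {Ex loop} => [|[] y] // _ _; sto.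
- by look; rewrite size_nseq; lia.
- by look; rewrite rev_nseq; sto.
Qed.

(** Missing bits count as zeros, so the loop of [add] needs no case distinction on which numeral
    ends first. *)
Lemma addc_step z x y : [|| x != [::], y != [::] | z] ->
  let a := head false x in let b := head false y in
  addc z x y = (a (+) b (+) z) ::
    addc [|| a && b, a && z | b && z] (behead x) (behead y).
Proof.
have E c v : addc c [::] v = incc c v by case: v.
have E' c v : addc c v [::] = incc c v by case: v.
case: x y => [|a x] [|b y] //=; rewrite ?E ?E' ?addbF ?orbF ?andbF //.
- by case: z.
- by case: z; case: b.
- by case: z; case: a.
Qed.

(* [b] becomes [a + b]; the carry is true when [c] is nonempty. *)
Definition add a b c s t :=
  fseq (bwhile (fun u => [|| u a != None, u b != None | u c != None])
     (bop (fun u => let x := u a == Some true in let y := u b == Some true in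
        let z := u c != None in
        [:: (a, Pop); (b, Pop); (t, Push (x (+) y (+) z));
            (c, if [|| x && y, x && z | y && z] then Push true else Clear)] ++
        (if u a is Some x then [:: (s, Push x)] else [::]))))
  (fseq (pour t b) (pour s a)).

Lemma add_runs (a b c s t : K) m : uniq [:: a; b; c; s; t] ->
  m c = [::] -> m s = [::] -> m t = [::] ->
  bruns (add a b c s t) m (6 * (size (m a) + size (m b)) + 7)
    (upd m b (addc false (m a) (m b))).
Proof.
move=> U mc ms mt.
have [[ab ac as_ at_] [bc bs bt] [cs ct] st] :
   [/\ [/\ a <> b, a <> c, a <> s & a <> t], [/\ b <> c, b <> s & b <> t],
       c <> s /\ c <> t & s <> t].
  move: U; rewrite /= !inE !negb_or !andbT.
  move=> /and4P[/and4P[? ? ? ?] /and3P[? ? ?] /andP[? ?] ?].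
  by do !split; apply/eqP.
rewrite /add; set loop := bwhile _ _.
(* The carry is part of the measure: it can yield one more bit after both numerals are used up. *)
have Hloop n m' (z : bool) : (size (m' a) + size (m' b) + z <= n)%N -> (m' c != [::]) = z ->
    bruns loop m' (2 * n + 1)
      (upd (upd (upd (upd (upd m' a [::]) b [::]) c [::]) s (rev (m' a) ++ m' s))
         t (rev (addc z (m' a) (m' b)) ++ m' t)).
  elim: n m' z => [|n IH] m' z le_n Ez.
    have [Ea Eb Ec] : [/\ m' a = [::], m' b = [::] & m' c = [::]].
      by move: le_n; rewrite -Ez; case: (m' a) (m' b) (m' c) => [|? ?] [|? ?] [|? ?].
    apply: bruns_eq; first by apply: bruns_while_false; rewrite /btops Ea Eb Ec.
    by rewrite Ea Eb -Ez Ec; sto.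
  have [Z|/negbTE Z] := boolP [|| m' a != [::], m' b != [::] | z]; last first.
    apply: bruns_le (IH m' z _ Ez) _; last by lia.
    by case: (m' a) (m' b) z Z {le_n Ez} => [|? ?] [|? ?] [].
  have hE k : (btops m' k == Some true) = head false (m' k).
    by rewrite /btops; case: (m' k) => [|[]].
  have nE k : (btops m' k != None) = (m' k != [::]) by rewrite /btops; case: (m' k).
  set ha := head false (m' a); set hb := head false (m' b).
  set z' := [|| ha && hb, ha && z | hb && z].
  pose m1 := upd (upd (upd (upd (upd m' a (behead (m' a))) b (behead (m' b)))
    t ((ha (+) hb (+) z) :: m' t)) c (if z' then true :: m' c else [::]))
    s (take 1 (m' a) ++ m' s).
  rewrite (_ : _ + 1 = (1 + (2 * n + 1)).+1)%N; last by lia.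
  apply: bruns_eq; first apply: (@bruns_while_true _ _ _ _ m1).
  - by rewrite !nE Ez.
  - apply: bruns_eq; first apply: bruns_op; rewrite ?map_cat ?cat_uniq.
      by case: (btops m' a) => [?|] /=; rewrite !inE !(introF eqP) //; congruence.
    rewrite /= !hE !nE Ez -/ha -/hb /m1 -/z' /btops.
    by case: (m' a) => [|x u] /=; rewrite ?take0; case: (z') => /=; sto.
  - apply: (IH _ z'); last by rewrite /m1; look; case: (z').
    rewrite /m1; look; move: Z le_n; rewrite !size_behead /z' /ha /hb.
    by case: (m' a) (m' b) (z) => [|x u] [|y v] [] //=;
      rewrite ?andbF ?orbF /=; try (case: x); try (case: y); rewrite //=; lia.
  - rewrite /m1; look; rewrite (addc_step Z) -/ha -/hb -/z' rev_cons cat_rcons.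
    rewrite (_ : rev (behead _) ++ _ = rev (m' a) ++ m' s); first by sto.
    by case: (m' a) => //= x u; rewrite rev_cons cat_rcons take0.
apply: bruns_eq; first apply: bruns_le.
- apply: bruns_seq; first by apply: (Hloop _ m false (leqnn _)); rewrite mc.
  by apply: bruns_seq; apply: pour_runs; congruence.
- look; rewrite ms mt !cats0 !size_rev.
  by have := size_addc false (m a) (m b); lia.
- by look; rewrite ms mt !(cats0, revK); sto.
Qed.

End BitPrograms.

Arguments bop {Gamma wk} a.
Arguments push {Gamma wk} k b.
Arguments clear {Gamma wk} k.
Arguments pop {Gamma wk} k.
Arguments pour {Gamma wk} a b.
Arguments pour2 {Gamma wk} a b c.
Arguments copy {Gamma wk} a b t.
Arguments revcopy {Gamma wk} a b t.
Arguments succ {Gamma wk} x t.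
Arguments add {Gamma wk} a b c s t.

(** * The program computing the gale *)

(* [W] is the part of the input that remains to be read, [NUM] and [DEN] are the
   value computed so far, least significant bit first, [X] is the first word of
   the current block in reverse, and [BLK] is the length of the block in unary. *)
Inductive mreg := W | NUM | DEN | X | BLK | NN | ND | CT0 | V | VC | XC | CT
  | Y | C2 | OX | OY | OF | Z | BAD | T1 | T2 | CA.

Definition mreg_code (r : mreg) : nat :=
  match r with
  | W => 0 | NUM => 1 | DEN => 2 | X => 3 | BLK => 4 | NN => 5 | ND => 6
  | CT0 => 7 | V => 8 | VC => 9 | XC => 10 | CT => 11 | Y => 12 | C2 => 13
  | OX => 14 | OY => 15 | OF => 16 | Z => 17 | BAD => 18 | T1 => 19 | T2 => 20
  | CA => 21
  end.

Definition mregs := [:: W; NUM; DEN; X; BLK; NN; ND; CT0; V; VC; XC; CT; Y; C2;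
  OX; OY; OF; Z; BAD; T1; T2; CA].

Lemma mreg_codeK : cancel mreg_code (nth W mregs).
Proof. by case. Qed.

HB.instance Definition _ := Countable.copy mreg (can_type mreg_codeK).

Lemma mregs_enum : Finite.axiom mregs.
Proof. by case. Qed.

HB.instance Definition _ := fintype.isFinite.Build mreg mregs_enum.

Section Program.

Variables (g h f : word -> word) (Mh Mf : oracleTM) (ph pf : nat -> nat) (j : nat).
Hypothesis Mh_h : forall x, @outputs_within Mh g x (h x) (ph (size x)).
Hypothesis Mf_f : forall x, @outputs_within Mf g x (f x) (pf (size x)).
Hypothesis ph_mono : {homo ph : m n / (m <= n)%N}.
Hypothesis pf_mono : {homo pf : m n / (m <= n)%N}.

(** On either side [None] encodes the blank of the machine concerned. *)
Definition Gam : finType := (option (extra Mh) + option (extra Mf))%type.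

Definition wk : finType :=
  (mreg + ((port + work Mh) * bool + (port + work Mf) * bool))%type.

Local Notation K := (port + wk)%type.
Local Notation A := (bool + Gam)%type.
Local Notation frag := (frag Gam wk).
Local Notation bstore := (bstore wk).
Local Notation bruns := (@bruns Gam wk g).
Local Notation "# r" := (inr (inl r) : K) (at level 2, format "# r").
Implicit Types (m : bstore) (k : K).
Local Notation HI := (inr (inr (inl (inl Input, true))) : K).
Local Notation FI := (inr (inr (inr (inl Input, true))) : K).

Definition ench (x : symbol (extra Mh)) : A :=
  match x with
  | Some (inl b) => inl b | Some (inr c) => inr (inl (Some c))
  | None => inr (inl None)
  end.

Definition dech (o : option A) : symbol (extra Mh) :=
  match o with
  | Some (inl b) => Some (inl b) | Some (inr (inl (Some c))) => Some (inr c)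
  | _ => None
  end.

Definition encf (x : symbol (extra Mf)) : A :=
  match x with
  | Some (inl b) => inl b | Some (inr c) => inr (inr (Some c))
  | None => inr (inr None)
  end.

Definition decf (o : option A) : symbol (extra Mf) :=
  match o with
  | Some (inl b) => Some (inl b) | Some (inr (inr (Some c))) => Some (inr c)
  | _ => None
  end.

Definition kaph (p : (port + work Mh) * bool) : K :=
  match p with
  | (inl Query, true) => inl Query | (inl Answer, true) => inl Answer
  | _ => inr (inr (inl p))
  end.

Definition kapf (p : (port + work Mf) * bool) : K :=
  match p with
  | (inl Query, true) => inl Query | (inl Answer, true) => inl Answer
  | _ => inr (inr (inr p))
  end.

Lemma kaph_inj : injective kaph.
Proof. by case=> [[[]|?] []] [[[]|?] []] //= [->]. Qed.

Lemma kapf_inj : injective kapf.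
Proof. by case=> [[[]|?] []] [[[]|?] []] //= [->]. Qed.

(** The stacks of the simulated machines, including query and answer; a call finds them empty, apart
    from its input, and leaves them empty. *)
Definition aux (k : K) : bool :=
  match k with inl Query | inl Answer | inr (inr _) => true | _ => false end.

Definition scratch (k : K) : bool :=
  match k with
  | inl Query | inl Answer | inr (inr _)
  | inr (inl OX) | inr (inl OY) | inr (inl OF) | inr (inl Z)
  | inr (inl T1) | inr (inl T2) | inr (inl CA) => true
  | _ => false
  end.

Definition clean (m : bstore) : Prop := forall k, scratch k -> m k = [::].

Lemma clean_upd m k v : ~~ scratch k -> clean m -> clean (upd m k v).
Proof.
move=> sk cm k' sk'; rewrite /upd; case: eqP sk' => [->|_ /cm //].
by rewrite (negbTE sk).
Qed.

Definition aux_clean (m : bstore) : Prop := forall k, aux k -> m k = [::].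

Lemma aux_clean_upd m k v : ~~ aux k -> aux_clean m -> aux_clean (upd m k v).
Proof.
move=> sk cm k' sk'; rewrite /upd; case: eqP sk' => [->|_ /cm //].
by rewrite (negbTE sk).
Qed.

Lemma clean_aux m : clean m -> aux_clean m.
Proof. by move=> cm k ak; apply: cm; case: k ak => [[]|[]]. Qed.

(** * Comparing two words by means of the selector *)

Definition callh (r : mreg) : frag := fcall ench dech kaph # r.
Definition callf (r : mreg) : frag := fcall encf decf kapf # r.

Lemma rho_reg (M : oracleTM) (kap : (port + work M) * bool -> K) r :
  (forall p, kap p <> # r) -> rho kap # r = None.
Proof. by rewrite /rho => H; case: pickP => // p /eqP /H. Qed.

Lemma callh_runs r m x : aux_clean m ->
  bruns (callh r) (upd m HI x) (7 * ph (size x) + 3)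
    (upd m # r (rev (h x) ++ m # r)).
Proof.
move=> cm; have mHI := cm HI isT.
apply: bruns_eq; first apply: fcall_runs (Mh_h x).
- by [].
- by case=> [[?|?]|].
- by case.
- exact: kaph_inj.
- by [].
- by [].
- by apply: rho_reg => -[[[]|?] []].
- by rewrite /=; look.
- by case=> [[[]|w] []] // _; rewrite /kaph; look; apply: cm.
- by rewrite /=; sto.
Qed.

Lemma callf_runs r m x : aux_clean m ->
  bruns (callf r) (upd m FI x) (7 * pf (size x) + 3)
    (upd m # r (rev (f x) ++ m # r)).
Proof.
move=> cm; have mFI := cm FI isT.
apply: bruns_eq; first apply: fcall_runs (Mf_f x).
- by [].
- by case=> [[?|?]|].
- by case.
- exact: kapf_inj.
- by [].
- by [].
- by apply: rho_reg => -[[[]|?] []].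
- by rewrite /=; look.
- by case=> [[[]|w] []] // _; rewrite /kapf; look; apply: cm.
- by rewrite /=; sto.
Qed.

(** The stack [a] holds a word in reverse, so its doubled bits come out in the right order in front
    of [b]; [z] keeps the plain word for the comparison with the selector's answer. *)
Definition dbl (a b z : K) : frag := bwhile (nonempty a)
  (fseq (bop (fun t => [:: (a, Pop); (b, Push (t a == Some true));
                       (z, Push (t a == Some true))]))
        (bop (fun t => [:: (b, Push (t b == Some true))]))).

Lemma dbl_runs a b z m : a <> b -> a <> z -> b <> z ->
  bruns (dbl a b z) m (3 * size (m a) + 1)
    (upd (upd (upd m a [::]) b (flatten [seq [:: x; x] | x <- rev (m a)] ++ m b))
      z (rev (m a) ++ m z)).
Proof.
move=> ab az bz.
pose S u v := upd (upd (upd m a v) b (flatten [seq [:: x; x] | x <- rev u] ++ m b))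
   z (rev u ++ m z).
have Em : m = S [::] (m a) by rewrite /S; sto.
have Et (d : bool) : (Some d == Some true) = d by case: d.
rewrite {1}Em mulnC; apply: (@bruns_while_pop _ _ _ a _ S) => [u v|u d v E].
  by rewrite /S; look.
apply: bruns_eq; first apply: (bruns_seq (n1 := 1) (n2 := 1)); first apply: bruns_op.
- by rewrite /= !inE !(introF eqP).
- exact: bruns_op.
- rewrite /= /S /btops /= rev_rcons /=; look; rewrite /= Et.
  by sto.
Qed.

Definition cmp : frag := bwhile (fun t => (t # Z != None) || (t # OX != None))
  (bop (fun t => [:: (# Z, Pop); (# OX, Pop)] ++
     (if t # Z == t # OX then [::] else [:: (# T2, Push true)]))).

Lemma cmp_runs m x y n : (size x + size y <= n)%N ->
  exists2 z : word, (z == [::]) = (x == y) && (m # T2 == [::]) &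
    bruns cmp (upd (upd m # Z x) # OX y) (2 * n + 1)
      (upd (upd (upd m # Z [::]) # OX [::]) # T2 z).
Proof.
elim: n m x y => [|n IH] m x y le_n.
  exists (m # T2); first by case: x y le_n => [|? ?] [|? ?].
  have [-> ->] : x = [::] /\ y = [::] by case: x y le_n => [|? ?] [|? ?].
  apply: bruns_eq; first by apply: bruns_while_false; rewrite /btops; look.
  by sto.
have [/andP[/eqP Ex /eqP Ey]|ne] := boolP ((x == [::]) && (y == [::])).
  have [|z Ez R] := IH m x y; first by rewrite Ex Ey.
  by exists z => //; apply: bruns_le R _; lia.
have [|z Ez R] := IH (if ohead x == ohead y then m else upd m # T2 (true :: m # T2))
  (behead x) (behead y).
  by move: ne le_n; case: (x) (y) => [|? ?] [|? ?] //=; lia.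
exists z.
  rewrite Ez; case: (ohead x =P ohead y) => Eh.
    by congr (_ && _); case: (x) (y) Eh => [|? ?] [|? ?] //= [->];
      rewrite eqseq_cons eqxx.
  by look; rewrite andbF; case: (x =P y) Eh => [->|].
rewrite (_ : _ + 1 = (1 + (2 * n + 1)).+1)%N; last by lia.
apply: (bruns_eq (bruns_while_true _ _ R)).
- by rewrite /btops; look; case: (x) (y) ne => [|? ?] [|? ?].
- apply: bruns_eq; first by apply: bruns_op; case: ifP.
  by rewrite /= /btops; look; case: ifP => _ /=; sto.
- by case: ifP => _; sto.
Qed.

(* Words are kept in reverse, as by [rev_succ]. *)
Definition dif (y x : word) : bool :=
  f (pairing (h (rev y)) (h (rev x))) != h (rev y).

(** The pair is built from its end: [h x], then the separator, then the doubled bits of [h y]. Each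
    word [y] that counts towards the score removes one element of [CT], which starts at the
    threshold and is counted down. *)
Definition Edif : frag :=
  fseq (revcopy # Y HI # T1) (fseq (callh OY)
  (fseq (revcopy # XC HI # T1) (fseq (callh OX)
  (fseq (pour # OX FI) (fseq (push FI true) (fseq (push FI false)
  (fseq (dbl # OY FI # Z) (fseq (callf OF) (fseq (pour # OF # OX)
  (fseq cmp (bif (nonempty # T2) (fseq (clear # T2) (pop # CT))
                 (bop (fun=> [::]))))))))))))).

Definition costE (n : nat) : nat :=
  (8 * n + 40 * ph n + 20 * pf (6 * ph n + 2) + 50)%N.

Lemma Edif_runs m n : clean m -> (size (m # Y) <= n)%N -> (size (m # XC) <= n)%N ->
  bruns Edif m (costE n)
    (upd m # CT (iter (dif (m # Y) (m # XC)) behead (m # CT))).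
Proof.
move=> cm ley lex.
have mHI := cm HI isT; have mFI := cm FI isT; have mT1 := cm # T1 isT.
have mOX := cm # OX isT; have mOY := cm # OY isT; have mOF := cm # OF isT.
have mZ := cm # Z isT; have mT2 := cm # T2 isT.
set y := m # Y in ley *; set x := m # XC in lex *.
set hy := h (rev y); set hx := h (rev x).
have leh u : (size u <= n)%N -> (size (h (rev u)) <= (ph n).*2)%N.
  move=> le_u; apply: leq_trans (outputs_within_size (Mh_h _)) _.
  by rewrite leq_double size_rev; apply: ph_mono.
have lehy := leh _ ley; have lehx := leh _ lex.
(* Both words have at most [2 * ph n] bits and the first is doubled, hence the factor 6. *)
have lep : (size (pairing hy hx) <= 6 * ph n + 2)%N.
  rewrite /pairing !size_cat size_flatten /shape -map_comp /=.
  rewrite (_ : sumn _ = (size hy).*2)%N; first by move: lehy lehx; rewrite -/hy -/hx; lia.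
  by elim: (hy) => //= ? ? ->; lia.
set fr := f (pairing hy hx).
have lefr : (size fr <= (pf (6 * ph n + 2)).*2)%N.
  apply: leq_trans (outputs_within_size (Mf_f _)) _.
  by rewrite leq_double; apply: pf_mono.
pose m2 := upd m # OY (rev hy).
pose m7 := upd m # Z hy.
have R1 : bruns (revcopy # Y HI # T1) m (4 * n + 2) (upd m HI (rev y)).
  apply: bruns_le; first (apply: bruns_eq; first by apply: revcopy_runs).
    by rewrite mHI cats0.
  by rewrite leq_add2r leq_mul2l ley orbT.
have R2 : bruns (callh OY) (upd m HI (rev y)) (7 * ph n + 3) m2.
  apply: bruns_le; first (apply: bruns_eq; first exact: callh_runs (clean_aux cm)).
    by rewrite mOY cats0.
  by rewrite leq_add2r leq_mul2l ph_mono ?orbT // size_rev.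
have cm2 : aux_clean m2 by apply: aux_clean_upd (clean_aux cm).
have R3 : bruns (revcopy # XC HI # T1) m2 (4 * n + 2) (upd m2 HI (rev x)).
  apply: bruns_le; first (apply: bruns_eq; first by apply: revcopy_runs; rewrite /m2; look).
    by rewrite /m2; look; rewrite mHI cats0.
  by rewrite /m2; look; rewrite leq_add2r leq_mul2l lex orbT.
have R4 : bruns (callh OX) (upd m2 HI (rev x)) (7 * ph n + 3) (upd m2 # OX (rev hx)).
  apply: bruns_le; first (apply: bruns_eq; first exact: callh_runs cm2).
    by rewrite /m2; look; rewrite mOX cats0.
  by rewrite leq_add2r leq_mul2l ph_mono ?orbT // size_rev.
have R5 : bruns (pour # OX FI) (upd m2 # OX (rev hx)) (4 * ph n + 1) (upd m2 FI hx).
  apply: bruns_le; first (apply: bruns_eq; first exact: pour_runs).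
    by rewrite /m2; look; rewrite revK mFI cats0; sto.
  by look; rewrite size_rev; move: lehx; rewrite -/hx; lia.
have R6 : bruns (push FI true) (upd m2 FI hx) 1 (upd m2 FI (true :: hx)).
  by apply: bruns_eq; [exact: push_runs | look; sto].
have R7 : bruns (push FI false) (upd m2 FI (true :: hx)) 1 (upd m2 FI [:: false, true & hx]).
  by apply: bruns_eq; [exact: push_runs | look; sto].
have R8 : bruns (dbl # OY FI # Z) (upd m2 FI [:: false, true & hx]) (6 * ph n + 1)
    (upd m7 FI (pairing hy hx)).
  apply: bruns_le; first (apply: bruns_eq; first exact: dbl_runs).
    by rewrite /m2 /m7 /pairing; look; rewrite revK mZ cats0; sto.
  by rewrite /m2; look; rewrite size_rev; move: lehy; rewrite -/hy; lia.
have cm7 : aux_clean m7 by apply: aux_clean_upd (clean_aux cm).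
have R9 : bruns (callf OF) (upd m7 FI (pairing hy hx)) (7 * pf (6 * ph n + 2) + 3)
    (upd m7 # OF (rev fr)).
  apply: bruns_le; first (apply: bruns_eq; first exact: callf_runs cm7).
    by rewrite /m7; look; rewrite mOF cats0.
  by rewrite leq_add2r leq_mul2l pf_mono ?orbT.
have R10 : bruns (pour # OF # OX) (upd m7 # OF (rev fr)) (4 * pf (6 * ph n + 2) + 1)
    (upd m7 # OX fr).
  apply: bruns_le; first (apply: bruns_eq; first exact: pour_runs).
    by rewrite /m7; look; rewrite revK mOX cats0; sto.
  by look; rewrite size_rev; lia.
have [|z Ez R11] := @cmp_runs m hy fr ((ph n).*2 + (pf (6 * ph n + 2)).*2).
  by apply: leq_add; rewrite // -/hy.
have R12 : bruns (bif (nonempty # T2) (fseq (clear # T2) (pop # CT)) (bop (fun=> [::])))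
    (upd (upd (upd m # Z [::]) # OX [::]) # T2 z) 3
    (upd m # CT (iter (dif y x) behead (m # CT))).
  apply: bruns_if; rewrite /nonempty /btops; look.
  have -> : dif y x = (z != [::]) by rewrite Ez mT2 andbT /dif eq_sym.
  case: (z) => [|? ?] /=.
    by apply: bruns_le; first (apply: bruns_eq; first exact: bruns_op); rewrite //=; sto.
  apply: bruns_eq; first apply: (bruns_seq (n1 := 1) (n2 := 1)).
  - exact: clear_runs.
  - exact: pop_runs.
  - by look; sto.
apply: bruns_le; first exact: (bruns_seq R1 (bruns_seq R2 (bruns_seq R3 (bruns_seq R4
  (bruns_seq R5 (bruns_seq R6 (bruns_seq R7 (bruns_seq R8 (bruns_seq R9
  (bruns_seq R10 (bruns_seq R11 R12))))))))))).
by rewrite /costE; lia.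
Qed.

(** * Scores, and thresholds consistent with a block *)

Lemma size_rev_succ x : (size (rev_succ x) <= (size x).+1)%N.
Proof. by elim: x => [|[] x IH] //=. Qed.

Lemma size_iter_rev_succ i x : (size (iter i rev_succ x) <= size x + i)%N.
Proof. by elim: i => [|i IH] /=; [lia | have := size_rev_succ (iter i rev_succ x); lia]. Qed.

Definition score (L : nat) (x0 x : word) : nat :=
  count (dif^~ x) (traject rev_succ x0 L).

Definition yloop : frag :=
  bwhile (nonempty # C2) (fseq (pop # C2) (fseq Edif (succ # Y # T1))).

Definition costY (n : nat) : nat := (costE n + 4 * n + 7)%N.

Lemma yloop_runs m n : clean m -> (size (m # Y) + size (m # C2) <= n)%N ->
  (size (m # XC) <= n)%N ->
  bruns yloop m (size (m # C2) * (costY n).+1 + 1)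
    (upd (upd (upd m # C2 [::]) # Y (iter (size (m # C2)) rev_succ (m # Y)))
      # CT (iter (score (size (m # C2)) (m # Y) (m # XC)) behead (m # CT))).
Proof.
move=> cm len lex.
pose S (u v : word) := upd (upd (upd m # C2 v) # Y (iter (size u) rev_succ (m # Y)))
      # CT (iter (score (size u) (m # Y) (m # XC)) behead (m # CT)).
have cS u v : clean (S u v) by rewrite /S; do 3![apply: clean_upd => //].
have Em : m = S [::] (m # C2) by rewrite /S; sto.
rewrite {1}Em; apply: (@bruns_while_pop _ _ _ # C2 _ S) => [u v|u d v E].
  by rewrite /S; look.
have lu : (size u < size (m # C2))%N by rewrite E size_cat /=; lia.
have ly := size_iter_rev_succ (size u) (m # Y).
have R1 : bruns (pop # C2) (S u (d :: v)) 1 (S u v).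
  by apply: bruns_eq; [exact: pop_runs | rewrite /S; sto].
have R2 : bruns Edif (S u v) (costE n) (upd (S u v) # CT
    (iter (score (size u).+1 (m # Y) (m # XC)) behead (m # CT))).
  apply: bruns_eq; first by apply: (Edif_runs (n := n) (cS u v)); rewrite /S; look; lia.
  rewrite /S; look; rewrite -iterD /score trajectSr -cats1 count_cat /= addn0 addnC.
  by [].
have R3 : bruns (succ # Y # T1) (upd (S u v) # CT
    (iter (score (size u).+1 (m # Y) (m # XC)) behead (m # CT))) (4 * n + 6)
    (S (rcons u d) v).
  apply: bruns_le; first (apply: bruns_eq; first apply: succ_runs).
  - by [].
  - by look; apply: cS.
  - by rewrite /S size_rcons; sto.
  - by rewrite /S; look; lia.
by apply: bruns_le; [exact: bruns_seq R1 (bruns_seq R2 R3) | rewrite /costY; lia].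
Qed.

(** The errors of the threshold [t] on [v]. Here [v] may be only a prefix of the block, while the
    scores always refer to all [L] words. *)
Definition nbad (L : nat) (x : word) (t : nat) (v : word) : nat :=
  count (fun i => nth false v i != (t <= score L x (iter i rev_succ x))%N)
    (iota 0 (size v)).

Lemma nbad_rcons L x t v b : nbad L x t (rcons v b) =
  (nbad L x t v + (b != (t <= score L x (iter (size v) rev_succ x))%N))%N.
Proof.
rewrite /nbad size_rcons -addn1 iotaD count_cat /= add0n nth_rcons ltnn eqxx addn0.
congr (_ + _)%N; apply: eq_in_count => i; rewrite mem_iota => /andP[_ iv].
by rewrite nth_rcons iv.
Qed.

Definition tbody : frag :=
  fseq (copy # CT0 # CT # T1) (fseq (copy # X # Y # T1) (fseq (copy # BLK # C2 # T1)
  (fseq yloop (fseq (clear # Y)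
  (fseq (bop (fun t => [:: (# VC, Pop); (# CT, Clear)] ++
     (if (t # VC == Some true) == (t # CT == None) then [::]
      else [:: (# BAD, Push true)])))
  (succ # XC # T1)))))).

Definition costT (n : nat) : nat :=
  (3 * (4 * n + 2) + (n * (costY n).+1 + 1) + 2 + (4 * n + 6))%N.

Lemma size_iter_behead n (s : word) : size (iter n behead s) = (size s - n)%N.
Proof. by elim: n => [|n IH] /=; rewrite ?subn0 // size_behead IH; lia. Qed.

Lemma tloop_runs m n (L := size (m # BLK)) (t := size (m # CT0)) (x := m # X) :
  clean m -> (size x + L <= n)%N -> (t <= n)%N -> (size (m # VC) <= L)%N ->
  m # C2 = [::] -> m # Y = [::] -> m # CT = [::] -> m # XC = x -> m # BAD = [::] ->
  bruns (bwhile (nonempty # VC) tbody) m (size (m # VC) * (costT n).+1 + 1)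
    (upd (upd (upd m # VC [::]) # XC (iter (size (m # VC)) rev_succ x))
      # BAD (nseq (nbad L x t (m # VC)) true)).
Proof.
move=> cm lex let_ leV mC2 mY mCT mXC mBAD.
pose S (u v : word) := upd (upd (upd m # VC v) # XC (iter (size u) rev_succ x))
      # BAD (nseq (nbad L x t u) true).
have cS u v : clean (S u v) by rewrite /S; do 3![apply: clean_upd => //].
have Em : m = S [::] (m # VC) by rewrite /S; sto.
rewrite {1}Em; apply: (@bruns_while_pop _ _ _ # VC _ S) => [u v|u d v E].
  by rewrite /S; look.
have lu : (size u < size (m # VC))%N by rewrite E size_cat /=; lia.
have lx := size_iter_rev_succ (size u) x.
set s0 := S u (d :: v).
have T0 : s0 # T1 = [::] by apply: cS.
have R1 : bruns (copy # CT0 # CT # T1) s0 (4 * n + 2) (upd s0 # CT (m # CT0)).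
  apply: bruns_le; first (apply: bruns_eq; first by apply: copy_runs).
    by rewrite /s0 /S; look; rewrite mCT cats0.
  by rewrite /s0 /S; look; rewrite -/t; lia.
have R2 : bruns (copy # X # Y # T1) (upd s0 # CT (m # CT0)) (4 * n + 2)
    (upd (upd s0 # CT (m # CT0)) # Y x).
  apply: bruns_le; first (apply: bruns_eq; first by apply: copy_runs; look).
    by rewrite /s0 /S; look; rewrite mY cats0.
  by rewrite /s0 /S; look; rewrite -/x; lia.
set s2 := upd (upd s0 # CT _) # Y x in R2.
have R3 : bruns (copy # BLK # C2 # T1) s2 (4 * n + 2) (upd s2 # C2 (m # BLK)).
  apply: bruns_le; first (apply: bruns_eq; first by apply: copy_runs; rewrite /s2; look).
    by rewrite /s2 /s0 /S; look; rewrite mC2 cats0.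
  by rewrite /s2 /s0 /S; look; rewrite -/L; lia.
set sc := score L x (iter (size u) rev_succ x).
pose s4 := upd s0 # CT (iter sc behead (m # CT0)).
have R4 : bruns yloop (upd s2 # C2 (m # BLK)) (n * (costY n).+1 + 1)
    (upd s4 # Y (iter L rev_succ x)).
  apply: bruns_le; first (apply: bruns_eq; first apply: (yloop_runs (n := n))).
  - by apply: clean_upd => //; apply: clean_upd => //; apply: clean_upd => //; apply: cS.
  - by rewrite /s2; look.
  - by rewrite /s2 /s0 /S; look; lia.
  - by rewrite /s2 /s4 /s0 /S; look; rewrite -/L -/sc; sto.
  - by look; rewrite leq_add2r leq_mul2r -/L; apply/orP; right; lia.
have R5 : bruns (clear # Y) (upd s4 # Y (iter L rev_succ x)) 1 s4.
  by apply: bruns_eq; [exact: clear_runs | rewrite /s4 /s0 /S; sto].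
pose s6 := upd (upd (upd m # VC v) # XC (iter (size u) rev_succ x))
      # BAD (nseq (nbad L x t (rcons u d)) true).
have R6 : bruns (bop (fun t => [:: (# VC, Pop); (# CT, Clear)] ++
     (if (t # VC == Some true) == (t # CT == None) then [::]
      else [:: (# BAD, Push true)]))) s4 1 s6.
  apply: bruns_eq; first by apply: bruns_op; case: ifP.
  rewrite /= /s6 /s4 /s0 /S /btops; look; rewrite nbad_rcons -/sc.
  (* [CT] had height [t] and lost one element per point of the score, so it is empty exactly when
     [t <= sc]. *)
  have -> : (ohead (iter sc behead (m # CT0)) == None) = (t <= sc)%N.
    by rewrite -subn_eq0 -size_iter_behead; case: (iter _ _ _).
  have -> : (ohead (d :: v) == Some true) = d by case: (d).
  by case: (d == _) => /=; rewrite ?addn0 ?addn1; sto.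
have R7 : bruns (succ # XC # T1) s6 (4 * n + 6) (S (rcons u d) v).
  apply: bruns_le; first (apply: bruns_eq; first apply: succ_runs).
  - by [].
  - by rewrite /s6; look; apply: cm.
  - by rewrite /s6 /S size_rcons; sto.
  - by rewrite /s6; look; lia.
apply: bruns_le; first exact: (bruns_seq R1 (bruns_seq R2 (bruns_seq R3 (bruns_seq R4
  (bruns_seq R5 (bruns_seq R6 R7)))))).
by rewrite /costT; lia.
Qed.

(* The threshold is the height of the loop counter [CT0]. *)
Definition tstep : frag :=
  fseq (pop # CT0) (fseq (add # DEN # ND # CA # T2 # T1)
  (fseq (copy # X # XC # T1) (fseq (copy # V # VC # T1)
  (fseq (bwhile (nonempty # VC) tbody) (fseq (clear # XC)
  (bif (nonempty # BAD) (clear # BAD) (add # NUM # NN # CA # T2 # T1))))))).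

Definition costS (n B : nat) : nat :=
  ((n * (costT n).+1 + 1) + 2 * (12 * B + 7) + 2 * (4 * n + 2) + 3)%N.

(** The thresholds are listed from [L] down to 0, as the loop meets them; its partial counts are
    then counts over initial segments of [iota]. *)
Definition cnt (L : nat) (x v : word) : nat :=
  count (fun i => nbad L x (L - i) v == 0%N) (iota 0 L.+1).

(** The multiplications are folded into the loop: [DEN] is added once for each of the [L + 1]
    thresholds and [NUM] once for each consistent one, so the value is multiplied by the share of
    consistent thresholds. *)
Lemma thresholds_runs m n B (L := size (m # BLK)) (x := m # X) (v := m # V) :
  clean m -> (size x + L <= n)%N -> (size v <= L)%N ->
  (size (m # NUM) + L.+1 <= B)%N -> (size (m # DEN) + L.+1 <= B)%N ->
  (forall r : mreg, r \in [:: C2; Y; CT; XC; BAD; VC; NN; ND] -> m # r = [::]) ->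
  m # CT0 = nseq L.+1 true ->
  bruns (bwhile (nonempty # CT0) tstep) m (L.+1 * (costS n B).+1 + 1)
    (upd (upd (upd m # CT0 [::]) # ND (iter L.+1 (addc false (m # DEN)) [::]))
      # NN (iter (cnt L x v) (addc false (m # NUM)) [::])).
Proof.
move=> cm lex lev leN leD mE mCT0.
have mC2 := mE C2 isT; have mY := mE Y isT; have mCT := mE CT isT.
have mXC := mE XC isT; have mBAD := mE BAD isT; have mVC := mE VC isT.
have mNN := mE NN isT; have mND := mE ND isT.
pose num (u : word) := iter (count (fun i => nbad L x (L - i) v == 0%N) (iota 0 (size u)))
  (addc false (m # NUM)) [::].
pose den (u : word) := iter (size u) (addc false (m # DEN)) [::].
pose S (u w : word) := upd (upd (upd m # CT0 w) # ND (den u)) # NN (num u).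
have cS u w : clean (S u w) by rewrite /S; do 3![apply: clean_upd => //].
have sz : L.+1 = size (m # CT0) by rewrite mCT0 size_nseq.
have Em : m = S [::] (m # CT0) by rewrite /S; sto.
rewrite {1}Em {1}sz (_ : upd _ _ _ = S (m # CT0) [::]); last first.
  by rewrite /S /num /den -sz /cnt.
apply: (@bruns_while_pop _ _ _ # CT0 _ S) => [u w|u d w E].
  by rewrite /S; look.
have Ew : size w = (L - size u)%N.
  by move: sz; rewrite E size_cat /=; lia.
have lu : (size u <= L)%N by move: sz; rewrite E size_cat /=; lia.
have szn : (size (num u) <= B)%N.
  apply: leq_trans (size_iter_addc _ _) _; apply: leq_trans leN.
  rewrite leq_add2l; apply: leq_trans (count_size _ _) _; rewrite size_iota; lia.
have szd : (size (den u) <= B)%N.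
  by apply: leq_trans (size_iter_addc _ _) _; lia.
have R1 : bruns (pop # CT0) (S u (d :: w)) 1 (S u w).
  by apply: bruns_eq; [exact: pop_runs | rewrite /S; sto].
pose s2 := upd (upd (upd m # CT0 w) # ND (den (rcons u d))) # NN (num u).
have cs2 : clean s2 by rewrite /s2; do 3![apply: clean_upd => //].
have R2 : bruns (add # DEN # ND # CA # T2 # T1) (S u w) (12 * B + 7) s2.
  apply: bruns_le; first (apply: bruns_eq; first apply: add_runs => //).
  - exact: cS.
  - exact: cS.
  - exact: cS.
  - by rewrite /s2 /S /den size_rcons; sto.
  - by rewrite /S; look; lia.
have R3 : bruns (copy # X # XC # T1) s2 (4 * n + 2) (upd s2 # XC x).
  apply: bruns_le; first (apply: bruns_eq; first by apply: copy_runs => //; apply: cs2).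
    by rewrite /s2; look; rewrite mXC cats0.
  by rewrite /s2; look; rewrite -/x; lia.
have cs3 : clean (upd s2 # XC x) by apply: clean_upd.
have R4 : bruns (copy # V # VC # T1) (upd s2 # XC x) (4 * n + 2)
    (upd (upd s2 # XC x) # VC v).
  apply: bruns_le; first (apply: bruns_eq; first by apply: copy_runs => //; apply: cs3).
    by rewrite /s2; look; rewrite mVC cats0.
  by rewrite /s2; look; rewrite -/v; lia.
have cs4 : clean (upd (upd s2 # XC x) # VC v) by apply: clean_upd.
set bad := nbad L x (L - size u) v.
have R5 : bruns (bwhile (nonempty # VC) tbody) (upd (upd s2 # XC x) # VC v)
    (n * (costT n).+1 + 1)
    (upd (upd s2 # XC (iter (size v) rev_succ x)) # BAD (nseq bad true)).
  apply: bruns_le; first (apply: bruns_eq; first apply: (tloop_runs (n := n) cs4)).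
  all: rewrite /s2; look => //; rewrite -/L -/x -/v ?Ew ?leq_add2r ?leq_mul2r; try lia.
  by rewrite -/bad; sto.
have R6 : bruns (clear # XC)
    (upd (upd s2 # XC (iter (size v) rev_succ x)) # BAD (nseq bad true))
    1 (upd s2 # BAD (nseq bad true)).
  by apply: bruns_eq; [exact: clear_runs | rewrite /s2; sto].
have R7 : bruns (bif (nonempty # BAD) (clear # BAD) (add # NUM # NN # CA # T2 # T1))
    (upd s2 # BAD (nseq bad true)) (12 * B + 7).+1 (S (rcons u d) w).
  apply: bruns_if; rewrite /nonempty /btops; look.
  have En : num (rcons u d) = iter (bad == 0%N) (addc false (m # NUM)) (num u).
    by rewrite /num size_rcons -addn1 iotaD count_cat /= add0n addn0 addnC iterD.
  case Ebad: bad En => [|b] /= En.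
    have -> : upd s2 # BAD [::] = s2 by rewrite /s2; sto.
    apply: bruns_le; first (apply: bruns_eq; first apply: add_runs => //).
    - exact: cs2.
    - exact: cs2.
    - exact: cs2.
    - by rewrite /S /s2; look; rewrite En; sto.
    - rewrite /s2; look; rewrite leq_add2r (_ : 12 * B = 6 * (B + B))%N; last by lia.
      by rewrite leq_mul2l; apply: leq_add szn; apply: leq_trans leN; apply: leq_addr.
  apply: bruns_le; first (apply: bruns_eq; first exact: clear_runs).
    by rewrite /S /s2 En; sto.
  by lia.
apply: bruns_le; first exact: (bruns_seq R1 (bruns_seq R2 (bruns_seq R3 (bruns_seq R4
  (bruns_seq R5 (bruns_seq R6 R7)))))).
by rewrite /costS; lia.
Qed.

(** * Processing all blocks of the prefix *)

Definition mvover (a b : K) : frag :=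
  fseq (clear b) (fseq (pour a # T1) (pour # T1 b)).

Lemma mvover_runs a b m : a <> b -> a <> # T1 -> b <> # T1 -> m # T1 = [::] ->
  bruns (mvover a b) m (4 * size (m a) + 3) (upd (upd m a [::]) b (m a)).
Proof.
move=> ab at_ bt mt; apply: bruns_le; first apply: bruns_eq.
- apply: bruns_seq; first exact: clear_runs.
  by apply: bruns_seq; apply: pour_runs; congruence.
- by look; rewrite mt !(cats0, revK); sto.
- by look; rewrite mt cats0 size_rev; lia.
Qed.

Definition mst (w x : word) (L : nat) (num den : word) : bstore :=
  upd (upd (upd (upd (upd (fun=> [::]) # W w) # X x) # BLK (nseq L true))
    # NUM num) # DEN den.

Lemma clean_mst w x L num den : clean (mst w x L num den).
Proof. by rewrite /mst; do 5![apply: clean_upd => //]. Qed.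

(** The counter [C2] runs down even when [W] is exhausted, because the last block may be
    incomplete. *)
Definition split_w : frag := bwhile (nonempty # C2)
  (bop (fun t => [:: (# C2, Pop); (# W, Pop)] ++
     (if t # W is Some b then [:: (# T2, Push b)] else [::]))).

Lemma split_w_runs m : m # T2 = [::] ->
  bruns split_w m (2 * size (m # C2) + 1)
    (upd (upd (upd m # C2 [::]) # W (drop (size (m # C2)) (m # W)))
      # T2 (rev (take (size (m # C2)) (m # W)))).
Proof.
move=> mT2; pose S (u v : word) := upd (upd (upd m # C2 v) # W (drop (size u) (m # W)))
      # T2 (rev (take (size u) (m # W))).
have Em : m = S [::] (m # C2) by rewrite /S drop0 take0; sto.
rewrite {1}Em mulnC; apply: (@bruns_while_pop _ _ _ # C2 _ S) => [u v|u d v E].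
  by rewrite /S; look.
apply: bruns_eq; first by apply: bruns_op; case: (btops _ _).
rewrite /= /S /btops size_rcons; look.
case Ed: (drop (size u) (m # W)) => [|b w'] /=.
  have les : (size (m # W) <= size u)%N by rewrite -subn_eq0 -size_drop Ed.
  by rewrite !drop_oversize ?take_oversize //; [sto | exact: leqW..].
have lus : (size u < size (m # W))%N.
  by rewrite ltnNge; apply/negP => /drop_oversize; rewrite Ed.
have Eb : nth false (m # W) (size u) = b by rewrite -[size u]addn0 -nth_drop Ed.
rewrite (take_nth false lus) rev_rcons Eb.
have -> : drop (size u).+1 (m # W) = w' by rewrite -add1n -drop_drop Ed /= drop0.
by sto.
Qed.

Definition block : frag :=
  fseq (copy # BLK # C2 # T1) (fseq split_w (fseq (pour # T2 # V)
  (fseq (copy # BLK # CT0 # T1) (fseq (push # CT0 true)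
  (fseq (bwhile (nonempty # CT0) tstep) (fseq (clear # V)
  (fseq (mvover # NN # NUM) (fseq (mvover # ND # DEN) (fseq (push # X false)
  (fseq (copy # BLK # C2 # T1) (pour # C2 # BLK))))))))))).

Definition costB (n B : nat) : nat :=
  ((n.+1 * (costS n B).+1 + 1) + 18 * n + 8 * B + 30)%N.

Lemma block_runs w x L num den n B :
  (size x + L <= n)%N -> (size num + L.+1 <= B)%N -> (size den + L.+1 <= B)%N ->
  bruns block (mst w x L num den) (costB n B)
    (mst (drop L w) (false :: x) (L + L)
      (iter (cnt L x (take L w)) (addc false num) [::])
      (iter L.+1 (addc false den) [::])).
Proof.
move=> lex leN leD; set s0 := mst w x L num den.
set num' := iter (cnt _ _ _) _ _; set den' := iter L.+1 _ _.
have leL : (L <= n)%N by lia.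
have lt : (size (take L w) <= L)%N by rewrite size_take; case: ltnP.
have c0 : clean s0 by exact: clean_mst.
have R1 : bruns (copy # BLK # C2 # T1) s0 (4 * n + 2) (upd s0 # C2 (nseq L true)).
  apply: bruns_le; first (apply: bruns_eq; first by apply: copy_runs).
    by rewrite /s0 /mst; look; rewrite cats0.
  by rewrite /s0 /mst; look; rewrite size_nseq; lia.
have R2 : bruns split_w (upd s0 # C2 (nseq L true)) (2 * n + 1)
    (upd (upd s0 # W (drop L w)) # T2 (rev (take L w))).
  apply: bruns_le; first (apply: bruns_eq; first by apply: split_w_runs; look).
    by rewrite /s0 /mst; look; rewrite size_nseq; sto.
  by look; rewrite size_nseq; lia.
pose s3 := upd s0 # W (drop L w).
have R3 : bruns (pour # T2 # V) (upd s3 # T2 (rev (take L w))) (2 * n + 1)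
    (upd s3 # V (take L w)).
  apply: bruns_le; first (apply: bruns_eq; first by apply: pour_runs).
    by rewrite /s3 /s0 /mst; look; rewrite revK cats0; sto.
  by look; rewrite size_rev; lia.
have c3 : clean (upd s3 # V (take L w)) by do 2![apply: clean_upd => //].
have R4 : bruns (copy # BLK # CT0 # T1) (upd s3 # V (take L w)) (4 * n + 2)
    (upd (upd s3 # V (take L w)) # CT0 (nseq L true)).
  apply: bruns_le; first (apply: bruns_eq; first by apply: copy_runs => //; apply: c3).
    by rewrite /s3 /s0 /mst; look; rewrite cats0.
  by rewrite /s3 /s0 /mst; look; rewrite size_nseq; lia.
pose s5 := upd (upd s3 # V (take L w)) # CT0 (nseq L.+1 true).
have R5 : bruns (push # CT0 true) (upd (upd s3 # V (take L w)) # CT0 (nseq L true)) 1 s5.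
  by apply: bruns_eq; [exact: push_runs | rewrite /s5 /s3; sto].
have R6 : bruns (bwhile (nonempty # CT0) tstep) s5 (n.+1 * (costS n B).+1 + 1)
    (upd (upd (upd s3 # V (take L w)) # ND den') # NN num').
  apply: bruns_le; first (apply: bruns_eq; first apply: (thresholds_runs (n := n) (B := B))).
  - by apply: clean_upd.
  - by rewrite /s5 /s3 /s0 /mst; look; rewrite size_nseq.
  - by rewrite /s5 /s3 /s0 /mst; look; rewrite size_nseq.
  - by rewrite /s5 /s3 /s0 /mst; look; rewrite size_nseq.
  - by rewrite /s5 /s3 /s0 /mst; look; rewrite size_nseq.
  - by case; rewrite //= /s5 /s3 /s0 /mst => _; look.
  - by rewrite /s5 /s3 /s0 /mst; look; rewrite size_nseq.
  - by rewrite /s5 /s3 /s0 /mst; look; rewrite size_nseq -/num' -/den'; sto.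
  - by rewrite /s5 /s3 /s0 /mst; look; rewrite size_nseq leq_add2r leq_mul2r; lia.
have R7 : bruns (clear # V) (upd (upd (upd s3 # V (take L w)) # ND den') # NN num') 1
    (upd (upd s3 # ND den') # NN num').
  by apply: bruns_eq; [exact: clear_runs | rewrite /s3 /s0 /mst; sto].
have R8 : bruns (mvover # NN # NUM) (upd (upd s3 # ND den') # NN num') (4 * B + 3)
    (upd (upd s3 # ND den') # NUM num').
  apply: bruns_le; first (apply: bruns_eq; first by apply: mvover_runs; look).
    by rewrite /s3 /s0 /mst; look; sto.
  look; rewrite leq_add2r leq_mul2l /=; apply: leq_trans (size_iter_addc _ _) _.
  apply: leq_trans leN; rewrite leq_add2l; apply: leq_trans (count_size _ _) _.
  by rewrite size_iota.
have R9 : bruns (mvover # ND # DEN) (upd (upd s3 # ND den') # NUM num') (4 * B + 3)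
    (upd (upd s3 # NUM num') # DEN den').
  apply: bruns_le; first (apply: bruns_eq; first by apply: mvover_runs; look).
    by rewrite /s3 /s0 /mst; look; sto.
  by look; rewrite leq_add2r leq_mul2l /=; apply: leq_trans (size_iter_addc _ _) leD.
pose s9 := upd (upd s3 # NUM num') # DEN den'.
have R10 : bruns (push # X false) s9 1 (upd s9 # X (false :: x)).
  by apply: bruns_eq; [exact: push_runs | rewrite /s9 /s3 /s0 /mst; look].
have R11 : bruns (copy # BLK # C2 # T1) (upd s9 # X (false :: x)) (4 * n + 2)
    (upd (upd s9 # X (false :: x)) # C2 (nseq L true)).
  apply: bruns_le; first (apply: bruns_eq; first by apply: copy_runs; rewrite /s9 /s3; look).
    by rewrite /s9 /s3 /s0 /mst; look; rewrite cats0.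
  by rewrite /s9 /s3 /s0 /mst; look; rewrite size_nseq; lia.
have R12 : bruns (pour # C2 # BLK)
    (upd (upd s9 # X (false :: x)) # C2 (nseq L true)) (2 * n + 1)
    (mst (drop L w) (false :: x) (L + L) num' den').
  apply: bruns_le; first (apply: bruns_eq; first by apply: pour_runs).
    rewrite /s9 /s3 /s0 /mst; look; rewrite rev_nseq -nseqD.
    by sto.
  by look; rewrite size_nseq; lia.
apply: bruns_le; first exact: (bruns_seq R1 (bruns_seq R2 (bruns_seq R3 (bruns_seq R4
  (bruns_seq R5 (bruns_seq R6 (bruns_seq R7 (bruns_seq R8 (bruns_seq R9 (bruns_seq R10
  (bruns_seq R11 R12))))))))))).
by rewrite /costB; lia.
Qed.

(** The argument [n] is fuel; [|w|] is enough, as every round consumes at least one bit. *)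
Fixpoint blocks (n : nat) (w x : word) (L : nat) (num den : word) : word * word :=
  if n is n'.+1 then
    if w is [::] then (num, den) else
    blocks n' (drop L w) (false :: x) (L + L)
      (iter (cnt L x (take L w)) (addc false num) [::])
      (iter L.+1 (addc false den) [::])
  else (num, den).

(** Since [L - 1] words precede a block of length [L], the invariant [L + |w| <= N + 1] keeps [L] at
    most [N] although [L] doubles each time. It may fail behind an incomplete last block, where [w]
    is empty. *)
Lemma blocks_runs (k : nat) w x L num den N B :
  (size w <= k)%N -> (0 < L)%N -> (size x < L)%N ->
  (w = [::] \/ (L + size w <= N.+1)%N) ->
  (size num + k * N.+1 <= B)%N -> (size den + k * N.+1 <= B)%N ->
  exists x' L', let nd := blocks k w x L num den in
  [/\ (size nd.1 <= B)%N, (size nd.2 <= B)%N &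
  bruns (bwhile (nonempty # W) block) (mst w x L num den)
    (k * (costB (2 * N) B).+1 + 1) (mst [::] x' L' nd.1 nd.2)].
Proof.
elim: k w x L num den => [|k IH] w x L num den lew L0 lex Hw leN leD.
  exists x, L => /=; have -> : w = [::] by case: (w) lew.
  by split; [lia | lia | apply: bruns_while_false; rewrite /nonempty /btops /mst; look].
case: w lew Hw => [|b w] lew Hw.
  exists x, L => /=; split; [lia | lia |].
  by apply: bruns_le; [apply: bruns_while_false; rewrite /nonempty /btops /mst; look | lia].
have leL : (L + size (b :: w) <= N.+1)%N by case: Hw.
have leL' : (L <= N)%N by move: leL; rewrite /=; lia.
have szN : (size (iter (cnt L x (take L (b :: w))) (addc false num) [::])
    <= size num + N.+1)%N.
  apply: leq_trans (size_iter_addc _ _) _; rewrite leq_add2l.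
  by apply: leq_trans (count_size _ _) _; rewrite size_iota.
have szD : (size (iter L.+1 (addc false den) [::]) <= size den + N.+1)%N.
  by apply: leq_trans (size_iter_addc _ _) _; rewrite leq_add2l.
have leN' : (size num + L.+1 <= B)%N by rewrite mulSn in leN; lia.
have leD' : (size den + L.+1 <= B)%N by rewrite mulSn in leD; lia.
have [||||||x' [L' [s1 s2 R]]] := IH (drop L (b :: w)) (false :: x) (L + L)%N
  (iter (cnt L x (take L (b :: w))) (addc false num) [::])
  (iter L.+1 (addc false den) [::]).
- by rewrite size_drop; move: lew; rewrite /=; lia.
- by lia.
- by rewrite /=; lia.
- have [le|lt] := leqP (size (b :: w)) L; first by left; apply: drop_oversize.
  by right; rewrite size_drop; move: lt leL; lia.
- by rewrite mulSn in leN; lia.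
- by rewrite mulSn in leD; lia.
exists x', L'; split; [exact: s1 | exact: s2 |].
rewrite (_ : k.+1 * _ + 1 = (costB (2 * N) B + (k * (costB (2 * N) B).+1 + 1)).+1)%N;
  last by rewrite mulSn; lia.
apply: bruns_while_true R; first by rewrite /nonempty /btops /mst; look.
(* The bound [2 * N] covers [size x + L], as [size x < L <= N]. *)
by apply: block_runs; lia.
Qed.

(** * The factor [2^(s |w|)] and the complete program *)

Fixpoint zeros (n : nat) (r : K) : frag :=
  if n is n'.+1 then fseq (push r false) (zeros n' r) else bop (fun=> [::]).

(** With the least significant bit on top these pushes multiply by [2 ^ n]. The number of pushes is
    built into the program, as [j] is fixed. *)
Lemma zeros_runs n r m : bruns (zeros n r) m n.+1 (upd m r (nseq n false ++ m r)).
Proof.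
elim: n m => [|n IH] m /=.
  by apply: bruns_eq; [exact: (@bruns_op _ _ _ (fun=> _)) | sto].
rewrite -(add1n n.+1); apply: bruns_eq.
  by apply: bruns_seq; [exact: push_runs | exact: IH].
look; have -> : nseq n false ++ false :: m r = false :: nseq n false ++ m r.
  by elim: n {IH} => //= n ->.
by sto.
Qed.

(* Multiplication of the numerator by [2 ^ j + 1] and of the denominator by
   [2 ^ j] *)
Definition facnum (num : word) : word :=
  addc false (nseq j false ++ num) (addc false num [::]).
Definition facden (den : word) : word := nseq j false ++ den.

Definition factor : frag :=
  fseq (add # NUM # NN # CA # T2 # T1) (fseq (zeros j # NUM)
  (fseq (add # NUM # NN # CA # T2 # T1) (fseq (mvover # NN # NUM) (zeros j # DEN)))).

Definition costF (B : nat) : nat := (28 * B + 2 * j + 19)%N.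

Lemma size_facnum num : (size (facnum num) <= size num + (j + 2))%N.
Proof.
apply: leq_trans (size_addc _ _ _) _; rewrite size_cat size_nseq.
by have := size_addc false num [::]; rewrite maxn0; lia.
Qed.

Lemma factor_runs m B : clean m -> m # NN = [::] -> (size (m # NUM) + (j + 2) <= B)%N ->
  bruns factor m (costF B)
    (upd (upd m # NUM (facnum (m # NUM))) # DEN (facden (m # DEN))).
Proof.
move=> cm mNN leB; set num := m # NUM in leB *.
have mT1 := cm # T1 isT; have mT2 := cm # T2 isT; have mCA := cm # CA isT.
have sz1 := size_addc false num [::]; rewrite maxn0 in sz1.
have sz2 := size_facnum num.
have R1 : bruns (add # NUM # NN # CA # T2 # T1) m (6 * B + 7)
    (upd m # NN (addc false num [::])).
  apply: bruns_le; first (apply: bruns_eq; first exact: add_runs).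
    by rewrite mNN.
  by rewrite mNN -/num /=; lia.
have R2 := zeros_runs j # NUM (upd m # NN (addc false num [::])).
have R3 : bruns (add # NUM # NN # CA # T2 # T1)
    (upd (upd m # NN (addc false num [::])) # NUM (nseq j false ++ num)) (12 * B + 7)
    (upd (upd m # NUM (nseq j false ++ num)) # NN (facnum num)).
  apply: bruns_le; first (apply: bruns_eq; first by apply: add_runs; look).
    by look; sto.
  by look; rewrite size_cat size_nseq; lia.
have R4 : bruns (mvover # NN # NUM) (upd (upd m # NUM (nseq j false ++ num)) # NN (facnum num))
    (4 * B + 3) (upd m # NUM (facnum num)).
  apply: bruns_le; first (apply: bruns_eq; first by apply: mvover_runs; look).
    by look; sto.
  by look; lia.
have R5 := zeros_runs j # DEN (upd m # NUM (facnum num)).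
apply: bruns_le; first (apply: bruns_eq; first apply: (bruns_seq R1 (bruns_seq _ (bruns_seq R3
  (bruns_seq R4 R5))))).
- by apply: bruns_eq; [exact: R2 | look].
- by look; sto.
- by rewrite /costF; lia.
Qed.

Local Notation Inp := (inl Input : K).
Local Notation Out := (inl Output : K).

(** Every decoded bit of [w] also multiplies the value by [1 + 2^-j]. The first unequal pair of bits
    is the separator; the precision behind it is discarded, the computed value being exact. *)
Definition decode : frag := bwhile (nonempty Inp)
  (fseq (bop (fun t => [:: (Inp, Pop); (# V, Push (t Inp == Some true))]))
  (bif (fun t => t Inp == t # V) (fseq (pop Inp) factor)
       (fseq (pop # V) (clear Inp)))).

(* The first component of a pair; it is defined on all words, because the
   machine must halt on every input. *)
Fixpoint dec (x : word) : word :=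
  if x is a :: (b :: x') then if a == b then a :: dec x' else [::] else [::].

Lemma size_dec x : (size (dec x) <= size x)%N.
Proof.
have [n] := ubnP (size x); elim: n x => // n IH [|a [|b x]] //= lt.
by case: eqP => //= _; have := IH x; lia.
Qed.

Lemma decode_runs n x m B : (size x <= n)%N -> clean m -> m # NN = [::] ->
  m Inp = x -> (size (m # NUM) + n * (j + 2) <= B)%N ->
  bruns decode m (n * (costF B + 4) + 5)
    (upd (upd (upd (upd m Inp [::]) # V (rev (dec x) ++ m # V))
      # NUM (iter (size (dec x)) facnum (m # NUM)))
      # DEN (iter (size (dec x)) facden (m # DEN))).
Proof.
elim: n x m => [|n IH] [|a x] m //= lex cm mNN mI leB.
- apply: bruns_le; first (apply: bruns_eq; first apply: bruns_while_false).
  + by rewrite /nonempty /btops mI.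
  + by sto.
  + by lia.
- apply: bruns_le; first (apply: bruns_eq; first apply: bruns_while_false).
  + by rewrite /nonempty /btops mI.
  + by sto.
  + by lia.
rewrite mulSn in leB.
have Ea : (Some a == Some true) = a by case: a {mI}.
pose m1 := upd (upd m Inp x) # V (a :: m # V).
have R1 : bruns (bop (fun t => [:: (Inp, Pop); (# V, Push (t Inp == Some true))])) m 1 m1.
  by apply: bruns_eq; [exact: bruns_op | rewrite /= /btops mI /= Ea /m1; sto].
have ne : nonempty Inp (btops m) by rewrite /nonempty /btops mI.
have [[x' Ex]|Ex] : (exists x', x = a :: x') \/ ohead x <> Some a.
  case: x {lex mI m1 R1} => [|b x]; first by right.
  by have [->|ba] := eqVneq b a; [left; exists x | right => -[/eqP]; apply/negP].
- pose m2 := upd (upd m Inp x') # V (a :: m # V).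
  have cm2 : clean m2 by do 2![apply: clean_upd => //].
  pose m3 := upd (upd m2 # NUM (facnum (m # NUM))) # DEN (facden (m # DEN)).
  have R2 : bruns (bif (fun t => t Inp == t # V) (fseq (pop Inp) factor)
       (fseq (pop # V) (clear Inp))) m1 (1 + costF B).+1 m3.
    apply: bruns_if; rewrite /btops /m1; look; rewrite Ex /= eqxx.
    apply: (bruns_seq (m1 := m2)).
      by apply: bruns_eq; [exact: pop_runs | rewrite /m2; sto].
    apply: bruns_eq; first apply: (factor_runs (B := B) cm2).
    - by rewrite /m2; look.
    - by rewrite /m2; look; apply: leq_trans leB; rewrite leq_add2l leq_addr.
    - by rewrite /m3 /m2; sto.
  have lex' : (size x' <= n)%N by move: lex; rewrite Ex /=; lia.
  have cm3 : clean m3 by do 2![apply: clean_upd => //].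
  have m3NN : m3 # NN = [::] by rewrite /m3 /m2; look.
  have m3I : m3 Inp = x' by rewrite /m3 /m2; look.
  have m3B : (size (m3 # NUM) + n * (j + 2) <= B)%N.
    rewrite /m3; look; apply: leq_trans leB; rewrite addnA leq_add2r.
    exact: size_facnum.
  have R3 := IH x' m3 lex' cm3 m3NN m3I m3B.
  apply: bruns_le; first (apply: bruns_eq;
    first exact: bruns_while_true ne (bruns_seq R1 R2) R3).
    rewrite Ex eqxx /= -!iterSr /= rev_cons cat_rcons /m3 /m2; look.
    by rewrite -?iterSr /=; sto.
  by rewrite mulSn; lia.
have -> : (if x is b :: x' then if a == b then a :: dec x' else [::] else [::]) = [::].
  by case: x Ex {lex mI m1 R1} => //= b x Eb; case: eqP => // ab; case: Eb; rewrite ab.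
have R2 : bruns (bif (fun t => t Inp == t # V) (fseq (pop Inp) factor)
       (fseq (pop # V) (clear Inp))) m1 3 (upd m Inp [::]).
  apply: bruns_if; rewrite (_ : (_ == _) = false); last first.
    by rewrite /btops /m1; look; apply/eqP.
  apply: (bruns_seq (n1 := 1) (n2 := 1)); first exact: pop_runs.
  by apply: bruns_eq; [exact: clear_runs | rewrite /m1; sto].
have R3 : bruns decode (upd m Inp [::]) 1 (upd m Inp [::]).
  by apply: bruns_while_false; rewrite /nonempty /btops; look.
apply: bruns_le; first (apply: bruns_eq;
  first exact: bruns_while_true ne (bruns_seq R1 R2) R3).
- by rewrite /=; sto.
- by lia.
Qed.

(** Both transfers reverse their numeral, which puts the most significant bit first. *)
Definition output : frag :=
  fseq (pour # DEN Out) (fseq (push Out true) (fseq (push Out false)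
  (dbl # NUM Out # V))).

Definition program : frag :=
  fseq (push # NUM true) (fseq (push # DEN true) (fseq (push # BLK true)
  (fseq decode (fseq (pour # V # W)
  (fseq (bwhile (nonempty # W) block) output))))).

Definition numden (w : word) : word * word :=
  blocks (size w) w [::] 1 (iter (size w) facnum [:: true]) (iter (size w) facden [:: true]).

Definition gale_word (x : word) : word :=
  let nd := numden (dec x) in pairing (rev nd.1) (rev nd.2).

(** Bits of the numerals: at most [j + 2] for each factor and [n + 1] for each of at most [n]
    blocks. *)
Definition bound (n : nat) : nat := (1 + n * (j + 2) + n * n.+1)%N.

Definition costP (n : nat) : nat :=
  (n * (costF (bound n) + 4) + n * (costB (2 * n) (bound n)).+1 + 2 * n + 5 * bound n + 20)%N.

Lemma program_runs x :
  exists m', bruns program (upd (fun=> [::]) Inp x) (costP (size x)) m'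
    /\ m' Out = gale_word x.
Proof.
set n := size x; set w := dec x; set B := bound n.
have lew : (size w <= n)%N := size_dec x.
set num := iter (size w) facnum [:: true]; set den := iter (size w) facden [:: true].
have szn : (size num <= 1 + n * (j + 2))%N.
  have H i : (size (iter i facnum [:: true]) <= 1 + i * (j + 2))%N.
    by elim: i => [//|i IH] /=; have := size_facnum (iter i facnum [:: true]); lia.
  by apply: leq_trans (H _) _; rewrite leq_add2l leq_mul2r lew orbT.
have szd : (size den <= 1 + n * (j + 2))%N.
  have H i : (size (iter i facden [:: true]) <= 1 + i * (j + 2))%N.
    by elim: i => [//|i IH] /=; rewrite size_cat size_nseq; lia.
  by apply: leq_trans (H _) _; rewrite leq_add2l leq_mul2r lew orbT.
have [||||||x' [L' [sN sD R6]]] := @blocks_runs (size w) w [::] 1 num den n B => //.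
- by right; rewrite add1n ltnS.
- by rewrite /B /bound leq_add // leq_mul2r lew orbT.
- by rewrite /B /bound leq_add // leq_mul2r lew orbT.
rewrite -/(numden w) in sN sD R6; set nd := numden w in sN sD R6.
pose s0 : bstore := upd (fun=> [::]) Inp x.
pose s3 := upd (upd (upd s0 # NUM [:: true]) # DEN [:: true]) # BLK [:: true].
have R1 := push_runs Gam g # NUM true s0.
have R2 := push_runs Gam g # DEN true (upd s0 # NUM [:: true]).
have R3 := push_runs Gam g # BLK true (upd (upd s0 # NUM [:: true]) # DEN [:: true]).
have R4 : bruns decode s3 (n * (costF B + 4) + 5)
   (upd (mst [::] [::] 1 num den) # V (rev w)).
  apply: bruns_eq; first apply: (decode_runs (n := n) (x := x) (B := B)) => //.
  - by do 4![apply: clean_upd => //].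
  - by rewrite /s3 /s0; look; rewrite /B /bound; apply: leq_addr.
  - by rewrite /s3 /s0 /mst; look; rewrite cats0 -/w; sto.
have R5 : bruns (pour # V # W) (upd (mst [::] [::] 1 num den) # V (rev w)) (2 * n + 1)
    (mst w [::] 1 num den).
  apply: bruns_le; first (apply: bruns_eq; first exact: pour_runs).
    by rewrite /mst; look; rewrite revK cats0; sto.
  by look; rewrite size_rev; lia.
set s6 := mst [::] x' L' _ _ in R6.
have R7 : bruns (pour # DEN Out) s6 (2 * B + 1)
   (upd (upd s6 # DEN [::]) Out (rev nd.2)).
  apply: bruns_le; first (apply: bruns_eq; first exact: pour_runs).
    by rewrite /s6 /mst; look; rewrite cats0.
  by rewrite /s6 /mst; look; lia.
have R8 := push_runs Gam g Out true (upd (upd s6 # DEN [::]) Out (rev nd.2)).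
have R9 := push_runs Gam g Out false
  (upd (upd (upd s6 # DEN [::]) Out (rev nd.2)) Out (true :: rev nd.2)).
set s9 := upd (upd (upd s6 # DEN [::]) Out (rev nd.2)) Out (true :: rev nd.2) in R9.
have R10 := @dbl_runs # NUM Out # V (upd s9 Out [:: false, true & rev nd.2]).
eexists; split.
  apply: bruns_le; first apply: bruns_seq.
  - by apply: bruns_eq; [exact: R1 | rewrite /s0; look].
  - apply: bruns_seq; first by apply: bruns_eq; [exact: R2 | rewrite /s0; look].
    apply: bruns_seq; first by apply: bruns_eq; [exact: R3 | rewrite /s0; look].
    apply: (bruns_seq R4); apply: (bruns_seq R5); apply: (bruns_seq R6).
    apply: (bruns_seq R7).
    apply: bruns_seq; first by apply: bruns_eq; [exact: R8 | look].
    apply: bruns_seq; first by apply: bruns_eq; [exact: R9 | rewrite /s9; look].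
    exact: R10.
  - rewrite /s9 /s6 /mst; look.
    have : (size w * (costB (2 * n) B).+1 <= n * (costB (2 * n) B).+1)%N.
      by rewrite leq_mul2r lew orbT.
    rewrite -/n /costP -/B; lia.
by rewrite /s9 /s6 /mst; look.
Qed.

End Program.

(** * Polynomial bounds *)

Definition poly (p : nat -> nat) : Prop :=
  exists c k : nat, forall n, (p n <= c * n ^ k + c)%N.

Lemma poly_const c : poly (fun=> c).
Proof. by exists c, 0%N => n; lia. Qed.

Lemma poly_id : poly (fun n => n).
Proof. by exists 1%N, 1%N => n; lia. Qed.

(** The [+ 1] is for [n = 0], where [0 ^ 0 = 1]. *)
Lemma leq_pow_add n k l : (n ^ k <= n ^ (k + l) + 1)%N.
Proof.
case: n => [|n]; first by case: k => [|k]; [rewrite expn0 leq_addl | rewrite exp0n].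
by apply: leq_trans (leq_addr _ _); rewrite leq_pexp2l // leq_addr.
Qed.

Lemma poly_add p q : poly p -> poly q -> poly (fun n => p n + q n)%N.
Proof.
move=> [c [k Hp]] [d [l Hq]]; exists (2 * (c + d))%N, (k + l)%N => n.
have := leq_pow_add n k l; have := leq_pow_add n l k; rewrite (addnC l k).
move: (Hp n) (Hq n); move: (n ^ k)%N (n ^ l)%N (n ^ (k + l))%N => a b e; nia.
Qed.

Lemma poly_mul p q : poly p -> poly q -> poly (fun n => p n * q n)%N.
Proof.
move=> [c [k Hp]] [d [l Hq]]; exists (4 * (c * d))%N, (k + l)%N => n.
apply: leq_trans (leq_mul (Hp n) (Hq n)) _.
have -> : ((c * n ^ k + c) * (d * n ^ l + d) = c * d * ((n ^ k).+1 * (n ^ l).+1))%N by lia.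
have -> : (4 * (c * d) * n ^ (k + l) + 4 * (c * d) = c * d * (4 * n ^ (k + l) + 4))%N by lia.
rewrite leq_mul2l; apply/orP; right.
have := leq_pow_add n k l; have := leq_pow_add n l k; rewrite (addnC l k).
by rewrite mulSn mulnS -expnD; lia.
Qed.

Lemma poly_exp p k : poly p -> poly (fun n => p n ^ k)%N.
Proof.
move=> Hp; elim: k => [|k IH]; first by exists 1%N, 0%N => n; rewrite expn0.
have [c' [k' H]] := poly_mul Hp IH.
by exists c', k' => n; rewrite expnS.
Qed.

Lemma poly_S p : poly p -> poly (fun n => (p n).+1).
Proof.
move=> Hp; have [c [k H]] := poly_add (poly_const 1) Hp.
by exists c, k => n; rewrite -add1n.
Qed.

Lemma poly_costP (c k c' k' j : nat) :
  poly (costP (fun n => c * n ^ k + c)%N (fun n => c' * n ^ k' + c')%N j).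
Proof.
rewrite /costP /costB /costS /costT /costY /costE /costF /bound.
by do ![apply: poly_add | apply: poly_mul | apply: poly_S | apply: poly_exp
  | apply: poly_id | apply: poly_const].
Qed.

Lemma gale_word_polytime (g h f : word -> word) (j : nat) :
  oracle_polytime g h -> oracle_polytime g f -> oracle_polytime g (gale_word h f j).
Proof.
move=> [Mh [c [k Hh]]] [Mf [c' [k' Hf]]].
have mono (a b : nat) : {homo (fun n => a * n ^ b + a)%N : m n / (m <= n)%N}.
  move=> m n le; rewrite leq_add2r leq_mul2l; apply/orP; right.
  by case: b => // b; rewrite leq_exp2r.
have [d [e Hd]] := poly_costP c k c' k' j.
apply: (@oracle_polytime_frag _ _ g (program Mh Mf j) _ d e) => x.
have [m' [R Em]] := @program_runs g h f Mh Mf _ _ j Hh Hf (mono _ _) (mono _ _) x.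
exists (costP (fun n => c * n ^ k + c)%N (fun n => c' * n ^ k' + c')%N j (size x)).
exists (@emb (Gam Mh Mf) (wk Mh Mf) m'); split; first exact: Hd.
  rewrite (_ : @input_store (Gam Mh Mf) (wk Mh Mf) x =
    @emb (Gam Mh Mf) (wk Mh Mf) (upd (fun=> [::]) (inl Input) x)).
    exact: R.
  by apply/funext => k1; rewrite /input_store /emb /upd; case: eqP.
by rewrite /emb -Em; elim: (m' _) => //= ? ? ->.
Qed.

Import Order.TTheory GRing.Theory Num.Theory.

(** * The gale *)

Lemma dec_pairing a b : dec (pairing a b) = a.
Proof. by elim: a => [|x a IH] //; rewrite /= eqxx; congr (_ :: _). Qed.

Lemma nat_of_word_rev x : nat_of_word (rev x) = lsb_val x.
Proof.
rewrite /nat_of_word foldl_rev; elim: x => //= b x ->.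
by rewrite addnC.
Qed.

(** Two successors run through both values of the lowest bit and carry once into the rest. *)
Lemma iter_rev_succ_double m x : iter m.*2 rev_succ (false :: x) = false :: iter m rev_succ x.
Proof. by elim: m => //= m ->. Qed.

(** This justifies passing to the next block by adding a single zero to its first word. *)
Lemma iter_rev_succ_nseq k : iter (2 ^ k) rev_succ (nseq k false) = nseq k.+1 false.
Proof. by elim: k => //= k IH; rewrite expnS mul2n iter_rev_succ_double IH. Qed.

Lemma count_ltn (T : eqType) (a b : pred T) (s : seq T) x :
  subpred a b -> x \in s -> b x -> ~~ a x -> (count a s < count b s)%N.
Proof.
move=> ab xs bx nax; elim: s xs => //= y s IH.
rewrite inE => /orP[/eqP <-|xs].
  by rewrite bx (negbTE nax) add0n add1n ltnS; apply: sub_count.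
have := IH xs; case Ea: (a y) => /=; first by rewrite (ab _ Ea) ltn_add2l.
by move=> lt; apply: leq_trans lt _; apply: leq_addl.
Qed.

(** * Counting the consistent thresholds *)

Section Counting.

Variables (h f : word -> word).

Lemma cnt_nil L x : cnt h f L x [::] = L.+1.
Proof. by rewrite /cnt /nbad /= count_predT size_iota. Qed.

(** A threshold predicts the next bit, so the thresholds consistent with [v] split according to that
    bit. *)
Lemma cnt_rcons L x v :
  (cnt h f L x (rcons v false) + cnt h f L x (rcons v true))%N = cnt h f L x v.
Proof.
rewrite /cnt; elim: (iota _ _) => //= i s IH; rewrite -IH !nbad_rcons.
by case: (_ <= _)%N; rewrite /= ?addn0 ?addn1 /=; lia.
Qed.

(* The words of a block that belong to [A] are those that are preferred to at
   least [t] words of the block, where [t] is the number of words of the block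
   outside [A]. *)
Lemma cnt_gt0 (A B : set word) (L : nat) (x0 : word) :
  (forall x, A x <-> B (h x)) ->
  (forall a b, (f (pairing a b) = a \/ f (pairing a b) = b) /\
     (B a \/ B b -> B (f (pairing a b)))) ->
  forall m, (m <= L)%N ->
  (0 < cnt h f L x0 (mkseq (fun i => rev (iter i rev_succ x0) \in A) m))%N.
Proof.
move=> hAB fB m le_mL.
pose a (y : word) := rev y \in A.
have aP y : reflect (B (h (rev y))) (a y).
  by apply: (iffP idP) => [/set_mem/hAB|/hAB/mem_set].
set s := traject rev_succ x0 L.
pose t := count (predC a) s.
have szs : size s = L by rewrite size_traject.
(* The selector must answer with a member of [B], and [h (rev y)] is not one. *)
have dif_out y x : a x -> ~~ a y -> dif h f y x.
  move=> /aP Bx /aP By; apply/eqP => E.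
  by apply: By; rewrite -E; apply: (fB _ _).2; right.
(* If [h (rev y)] were in [B], the answer could not be [h (rev x)], which is outside. *)
have out_dif y x : ~~ a x -> dif h f y x -> ~~ a y.
  move=> /aP Bx; apply: contra => /aP By; apply/eqP.
  have [[//|E] H] := fB (h (rev y)) (h (rev x)).
  by case: Bx; rewrite -E; apply: H; left.
have key i : (i < L)%N -> a (iter i rev_succ x0) =
    (t <= score h f L x0 (iter i rev_succ x0))%N.
  move=> iL; set x := iter i rev_succ x0.
  have xs : x \in s by apply/trajectP; exists i.
  case: (boolP (a x)) => [ax|nax]; apply/esym.
    by apply: sub_count => y; apply: dif_out.
  (* The inequality is strict because [x] itself is outside [A] but is not preferred to itself: the
     selector has no choice on a pair of equal words. *)
  apply/negbTE; rewrite -ltnNge; apply: (@count_ltn _ _ _ s x) => //.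
    by move=> y; apply: out_dif.
  by rewrite negbK; apply/eqP; case: (fB (h (rev x)) (h (rev x))) => -[].
(* The threshold [t] stands at position [L - t] in the descending list. *)
rewrite /cnt -has_count; apply/hasP; exists (L - t)%N.
  by rewrite mem_iota; lia.
have tL : (t <= L)%N by rewrite -szs count_size.
rewrite subKn // /nbad size_mkseq -leqn0 leqNgt -has_count; apply/hasPn => i.
rewrite mem_iota => /andP[_ lt_im]; rewrite negbK nth_mkseq // -key ?eqxx //.
exact: leq_trans lt_im le_mL.
Qed.

End Counting.

Local Open Scope ring_scope.

(** * The product measure and its gale *)

Section Gale.

Variables (R : realType) (h f : word -> word) (j : nat).

(** On an incomplete last block the factor is the share of thresholds consistent with the bits
    present, so that [mu] is additive at every bit and not only at the ends of blocks. *)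
Fixpoint mu (n : nat) (w x : word) (L : nat) : R :=
  if n is n'.+1 then
    if w is [::] then 1 else
    (cnt h f L x (take L w))%:R / L.+1%:R * mu n' (drop L w) (false :: x) (L + L)
  else 1.

Lemma mu_ge0 n w x L : 0 <= mu n w x L.
Proof.
elim: n w x L => [|n IH] [|b w] x L //=; try exact: ler01.
by rewrite mulr_ge0 // divr_ge0.
Qed.

Lemma mu_nil n x L : mu n [::] x L = 1.
Proof. by case: n. Qed.

(** Inside a block this is [cnt_rcons]. If the new bit opens a block, all [L + 1] thresholds are
    consistent with the empty prefix and the two shares add up to 1. *)
Lemma mu_rcons n w x L : (size w <= n)%N -> (0 < L)%N ->
  mu n.+1 (rcons w false) x L + mu n.+1 (rcons w true) x L = mu n w x L.
Proof.
have short (m : nat) v y M : (size v < M)%N ->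
    mu m.+1 (rcons v false) y M + mu m.+1 (rcons v true) y M =
    (cnt h f M y v)%:R / M.+1%:R.
  move=> lt; have H b : mu m.+1 (rcons v b) y M = (cnt h f M y (rcons v b))%:R / M.+1%:R.
    have -> : mu m.+1 (rcons v b) y M = (cnt h f M y (take M (rcons v b)))%:R / M.+1%:R *
      mu m (drop M (rcons v b)) (false :: y) (M + M) by case: v lt.
    by rewrite take_oversize ?drop_oversize ?size_rcons // mu_nil mulr1.
  by rewrite !H -mulrDl -natrD cnt_rcons.
elim: n w x L => [|n IH] w x L lew L0.
  have -> : w = [::] by case: (w) lew.
  by rewrite short // cnt_nil divff // pnatr_eq0.
have [ltw|leL] := ltnP (size w) L.
  rewrite short //; case: w ltw {lew} => [|b w] ltw.
    by rewrite cnt_nil divff // pnatr_eq0.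
  by rewrite [RHS]/= [take _ _]take_oversize ?[drop _ _]drop_oversize ?mu_nil ?mulr1 // ltnW.
have H b : mu n.+2 (rcons w b) x L = (cnt h f L x (take L w))%:R / L.+1%:R *
    mu n.+1 (rcons (drop L w) b) (false :: x) (L + L).
  have -> : mu n.+2 (rcons w b) x L = (cnt h f L x (take L (rcons w b)))%:R / L.+1%:R *
    mu n.+1 (drop L (rcons w b)) (false :: x) (L + L) by case: (w).
  by rewrite drop_rcons // -cats1 takel_cat.
rewrite !H -mulrDr IH //; last by rewrite addn_gt0 L0.
  by case: w lew leL {H} => [|b w] //; case: (L) L0.
by rewrite size_drop; lia.
Qed.



(** The number [2^s = 1 + 2^-j], as the quotient by which the program multiplies. *)
Definition base : R := (2 ^+ j + 1) / 2 ^+ j.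

Lemma exp2j_gt0 : 0 < 2 ^+ j :> R.
Proof. by rewrite exprn_gt0. Qed.

Lemma base_gt1 : 1 < base.
Proof. by rewrite /base ltr_pdivlMr ?exp2j_gt0 // mul1r ltrDl. Qed.

Lemma base_gt0 : 0 < base.
Proof. exact: lt_trans ltr01 base_gt1. Qed.

Definition ratio (F : fieldType) (nd : word * word) : F :=
  (lsb_val nd.1)%:R / (lsb_val nd.2)%:R.

Lemma blocks_val n w x L num den : (0 < lsb_val den)%N ->
  let nd := blocks h f n w x L num den in
  (0 < lsb_val nd.2)%N /\ ratio R nd = ratio R (num, den) * mu n w x L.
Proof.
elim: n w x L num den => [|n IH] [|b w] x L num den den0 /=; try by rewrite mulr1.
have den0' : (0 < lsb_val (addc false den (iter L (addc false den) [::])))%N.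
  by rewrite lsb_val_addc; lia.
have [pos ->] := IH (drop L (b :: w)) (false :: x) (L + L)%N
  (iter (cnt h f L x (take L (b :: w))) (addc false num) [::]) _ den0'.
split=> //; rewrite mulrA; congr (_ * _).
rewrite /ratio /= lsb_val_iter_addc -[addc _ _ _]/(iter L.+1 (addc false den) [::])
  lsb_val_iter_addc !natrM invfM.
by rewrite mulrACA mulrC.
Qed.

Lemma lsb_val_zeros n x : lsb_val (nseq n false ++ x) = (2 ^ n * lsb_val x)%N.
Proof. by elim: n => [|n IH] /=; rewrite ?mul1n // IH expnS; lia. Qed.

Lemma ratio_factors n :
  let num := iter n (facnum j) [:: true] in let den := iter n (facden j) [:: true] in
  (0 < lsb_val den)%N /\ ratio R (num, den) = base ^+ n.
Proof.
elim: n => [|n [IH1 IH2]] /=; first by rewrite /ratio /= divr1.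
rewrite {1}/facden lsb_val_zeros muln_gt0 expn_gt0 IH1; split=> //.
rewrite exprS -IH2 /ratio /= /facnum /facden !lsb_val_addc lsb_val_zeros /= !add0n !addn0.
rewrite -[(_ * _ + _)%N](_ : ((2 ^ j + 1) * lsb_val (iter n (facnum j) [:: true]) = _)%N);
  last by rewrite mulnDl mul1n.
by rewrite lsb_val_zeros !natrM natrD natrX invfM mulrACA.
Qed.

Definition dgale (w : word) : R := ratio R (numden h f j w).

Lemma numden_gt0 w : (0 < lsb_val (numden h f j w).2)%N.
Proof. exact: (blocks_val _ _ _ _ _ (ratio_factors _).1).1. Qed.

Lemma dgaleE w : dgale w = base ^+ size w * mu (size w) w [::] 1.
Proof. by rewrite /dgale (blocks_val _ _ _ _ _ (ratio_factors _).1).2 (ratio_factors _).2. Qed.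

Definition dexp : R := ln base / ln 2.

Lemma ln2_neq0 : ln 2 != 0 :> R.
Proof. by rewrite gt_eqF // ln_gt0 // ltr1n. Qed.

Lemma powR_dexp : 2 `^ (- dexp) = base^-1 :> R.
Proof.
rewrite powRN; congr (_^-1); rewrite /powR pnatr_eq0 /= /dexp divfK ?ln2_neq0 //.
by rewrite lnK // posrE base_gt0.
Qed.

Lemma dgale_gale : gale dexp dgale.
Proof.
split=> w; first by rewrite dgaleE mulr_ge0 ?mu_ge0 // exprn_ge0 // ltW ?base_gt0.
rewrite powR_dexp !dgaleE !size_rcons -mulrDr mu_rcons // exprS mulrA -mulrA mulrA mulrA.
by rewrite mulVf ?mul1r // gt_eqF ?base_gt0.
Qed.

Lemma dgale_polytime g : oracle_polytime g h -> oracle_polytime g f ->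
  oracle_polytime_real g dgale.
Proof.
move=> gh gf; exists (fun w _ => ratio rat (numden h f j w)); split=> [w r||w r].
- by rewrite divr_ge0.
- exists (gale_word h f j); split; first exact: gale_word_polytime.
  move=> w r; rewrite /gale_word dec_pairing.
  exists (rev (numden h f j w).1), (rev (numden h f j w).2).
  by rewrite !nat_of_word_rev numden_gt0.
- rewrite /dgale /ratio fmorph_div /= !ratr_nat subrr normr0.
  by rewrite invr_ge0 exprn_ge0.
Qed.

(** * Growth of the gale from block to block *)

Definition growth (k : nat) : R := base ^+ (2 ^ k) / (2 ^ k).+1%:R.

(** A lower bound for the gain on the blocks of the words of lengths [k] to [k + K - 1] of [A]: in
    each at least one threshold is consistent. *)
Fixpoint total_growth (k K : nat) : R :=
  if K is K'.+1 then growth k * total_growth k.+1 K' else 1.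

Lemma growth_gt0 k : 0 < growth k.
Proof. by rewrite divr_gt0 // exprn_gt0 // base_gt0. Qed.

Lemma total_growth_gt0 k K : 0 < total_growth k K.
Proof. by elim: K k => [|K IH] k //=; rewrite mulr_gt0 ?growth_gt0. Qed.

Lemma total_growthD k K K' :
  total_growth k (K + K') = total_growth k K * total_growth (k + K) K'.
Proof.
elim: K k => [|K IH] k /=; first by rewrite mul1r addn0.
by rewrite IH mulrA addSnnS.
Qed.

Lemma bernoulli_ineq (e : R) n : 0 <= e -> n%:R * e <= (1 + e) ^+ n.
Proof.
move=> e0; elim: n => [|n IH]; first by rewrite mul0r ler01.
have : 1 <= (1 + e) ^+ n by rewrite exprn_ege1 // lerDl.
rewrite exprS -natr1 mulrDl mul1r mulrDl mul1r => H.
by rewrite lerD // ler_peMr.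
Qed.

(** The linear bound for the full exponent does not beat the denominator, so it is applied to half
    the exponent and squared. With [m] half the block length and [p = 2^j], the square is
    [m^2 / p^2]. The condition on [k] gives [m >= 8 p^2], hence at least [8 m], which exceeds
    [2 (2 m + 1)]. *)
Lemma growth_ge2 k : (2 * j + 4 <= k)%N -> 2 <= growth k.
Proof.
case: k => [|k] lek; first by lia.
rewrite /growth ler_pdivlMr // -(natr1 (2 ^ k.+1)) expnS mulnC exprM natrM.
set m : R := (2 ^ k)%:R.
have leb : m / 2 ^+ j <= base ^+ (2 ^ k).
  have := @bernoulli_ineq (2 ^+ j)^-1 (2 ^ k).
  have -> : 1 + (2 ^+ j)^-1 = base.
    by rewrite /base mulrDl mul1r divff // gt_eqF // exp2j_gt0.
  by apply; rewrite invr_ge0 ltW // exp2j_gt0.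
have m8 : 8 * (2 ^+ j) ^+ 2 <= m.
  rewrite /m -exprM -natrX -[8]/((2 ^ 3)%N%:R) -natrM ler_nat -expnD.
  by rewrite leq_exp2l //; lia.
have p0 := exp2j_gt0; set p := 2 ^+ j in leb m8 p0 *.
apply: (@le_trans _ _ ((m / p) ^+ 2)); last first.
  by rewrite lerXn2r // nnegrE ?(le_trans _ leb) // divr_ge0 // ltW.
have p1 : 1 <= p by rewrite exprn_ege1 // ler1n.
rewrite expr_div_n ler_pdivlMr ?exprn_gt0 //.
have m1 : 1 <= m by nra.
nra.
Qed.

Lemma total_growth_ge k K : (2 * j + 4 <= k)%N -> 2 ^+ K <= total_growth k K.
Proof.
elim: K k => [|K IH] k lek //=; rewrite exprS ler_pM ?exprn_ge0 ?growth_ge2 //.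
by rewrite IH // ltnW.
Qed.

(** * Success on [A] *)

Section Success.

Variables (A B : set word).
Hypothesis hAB : forall x, A x <-> B (h x).
Hypothesis fB : forall a b, (f (pairing a b) = a \/ f (pairing a b) = b) /\
     (B a \/ B b -> B (f (pairing a b))).

Definition block_word (k m : nat) : word :=
  mkseq (fun i => rev (iter i rev_succ (nseq k false)) \in A) m.

(** The argument of [mu] is the part of the characteristic sequence of [A] that consists of [K]
    complete blocks. By [cnt_gt0] each block contributes at least [1 / (2 ^ k + 1)], with its own
    [k]. *)
Lemma total_growth_mu k K n : (2 ^ (k + K) - 2 ^ k <= n)%N ->
  total_growth k K <= base ^+ (2 ^ (k + K) - 2 ^ k) *
    mu n (block_word k (2 ^ (k + K) - 2 ^ k)) (nseq k false) (2 ^ k).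
Proof.
elim: K k n => [|K IH] k n; first by rewrite addn0 subnn mu_nil mulr1.
rewrite addnS -addSn; set M := (2 ^ (k.+1 + K))%N.
have le1 : (2 ^ k.+1 <= M)%N by rewrite leq_exp2l // leq_addr.
have k0 : (0 < 2 ^ k)%N by rewrite expn_gt0.
have E2 : (2 ^ k.+1 = 2 ^ k + 2 ^ k)%N by rewrite expnS mul2n addnn.
have E : (M - 2 ^ k = 2 ^ k + (M - 2 ^ k.+1))%N by lia.
case: n => [|n] len; first by lia.
have Et : take (2 ^ k) (block_word k (M - 2 ^ k)) = block_word k (2 ^ k).
  by rewrite /block_word /mkseq -map_take take_iota (minn_idPl _) //; lia.
have Ed : drop (2 ^ k) (block_word k (M - 2 ^ k)) = block_word k.+1 (M - 2 ^ k.+1).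
  rewrite /block_word /mkseq -map_drop drop_iota add0n E addKn.
  have -> n' : iota (2 ^ k) n' = map (addn (2 ^ k)) (iota 0 n') by rewrite -iotaDl addn0.
  rewrite -map_comp.
  by apply: eq_map => i /=; rewrite addnC iterD iter_rev_succ_nseq.
have -> : mu n.+1 (block_word k (M - 2 ^ k)) (nseq k false) (2 ^ k) =
    (cnt h f (2 ^ k) (nseq k false) (block_word k (2 ^ k)))%:R / (2 ^ k).+1%:R *
    mu n (block_word k.+1 (M - 2 ^ k.+1)) (nseq k.+1 false) (2 ^ k.+1).
  have : (0 < size (block_word k (M - 2 ^ k)))%N by rewrite size_mkseq; lia.
  by rewrite -Et -Ed E2; case: (block_word k (M - 2 ^ k)).
have c0 : (0 < cnt h f (2 ^ k) (nseq k false) (block_word k (2 ^ k)))%N.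
  exact: cnt_gt0 hAB fB _ _.
rewrite {1}E exprD /= mulrACA; apply: ler_pM.
- exact/ltW/growth_gt0.
- exact/ltW/total_growth_gt0.
- rewrite /growth ler_pM2l ?exprn_gt0 ?base_gt0 // ler_peMl ?invr_ge0 //.
  by rewrite ler1n.
- by apply: IH; lia.
Qed.

Lemma dgale_succeeds : succeeds dgale A.
Proof.
rewrite /succeeds limn_esup_lim.
(* It is enough that every tail of the sequence is unbounded. *)
suff -> : esups (fun n => (dgale (char_prefix A n))%:E) = (fun=> +oo%E) by rewrite lim_cst.
apply/funext => N; set S := sdrop (fun n => (dgale (char_prefix A n))%:E) N.
rewrite -[LHS]/(ereal_sup S).
have big K : (N <= K)%N -> S (dgale (char_prefix A (2 ^ K - 1)))%:E.
  move=> le_NK; exists (2 ^ K - 1)%N => //=.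
  by have := ltn_expl K (isT : 1 < 2)%N; lia.
have lower K : total_growth 0 K <= dgale (char_prefix A (2 ^ K - 1)).
  (* From [k = 0] on, [block_word] is by computation the prefix of the characteristic sequence. *)
  rewrite dgaleE size_mkseq; have := @total_growth_mu 0 K (2 ^ K - 1).
  by rewrite add0n; apply.
set k0 := (2 * j + 4)%N; set c := total_growth 0 k0.
have c0 : 0 < c := total_growth_gt0 0 k0.
have unbounded (r : R) : (r%:E <= ereal_sup S)%E.
  (* The first [k0] blocks contribute the positive constant [c], possibly tiny, and every later
     block at least doubles the value. So [m >= |r| / c] further blocks reach [r], and the maximum
     with [N] places the index in the tail. *)
  pose m := Num.Def.archi_bound (`|r| / c).
  apply: le_trans (ereal_sup_ubound (big (k0 + maxn N m)%N _)); last by lia.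
  rewrite lee_fin; apply: le_trans (lower _); rewrite total_growthD add0n -/c.
  apply: (@le_trans _ _ (c * 2 ^+ maxn N m)); last first.
    by rewrite ler_pM2l // total_growth_ge.
  apply: le_trans (ler_norm r) _; rewrite mulrC -ler_pdivrMr //.
  apply: (@le_trans _ _ m%:R).
    by apply/ltW/archi_boundP; rewrite divr_ge0 // ltW.
  rewrite -natrX ler_nat; apply: leq_trans (leq_maxr N m) _.
  exact/ltnW/ltn_expl.
case: (ereal_sup S) unbounded => [s|//|] H.
  by have := H (s + 1); rewrite lee_fin gerDl ler10.
by have := H 0.
Qed.

End Success.

End Gale.

(** By [ln (1 + x) <= x] the exponent is at most [2^-j / ln 2], and [2^j > j > 1 / (e ln 2)] for the
    chosen [j]. *)
Lemma exists_dexp_lt (R : realType) (e : R) : 0 < e -> exists j : nat, dexp R j < e.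
Proof.
move=> e0; have l2 : 0 < ln 2 :> R by rewrite ln_gt0 // ltr1n.
exists (Num.Def.archi_bound (e * ln 2)^-1); set j := Num.Def.archi_bound _.
have p0 := exp2j_gt0 R j.
rewrite /dexp ltr_pdivrMr //.
have -> : base R j = 1 + (2 ^+ j)^-1.
  by rewrite /base mulrDl mul1r divff // gt_eqF.
apply: le_lt_trans (le_ln1Dx _) _.
  by apply: lt_trans (_ : 0 < _); rewrite ?invr_gt0 // ltrN10.
rewrite invf_plt ?posrE ?mulr_gt0 //.
apply: (@lt_trans _ _ j%:R); last by rewrite -natrX ltr_nat ltn_expl.
by apply: archi_boundP; rewrite invr_ge0 mulr_ge0 // ltW.
Qed.

(** Without query states the step function is the same for all oracles. *)
Lemma polytime_oracle_polytime (g h : word -> word) : polytime h -> oracle_polytime g h.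
Proof.
move=> [M [ask0 [c [k H]]]]; exists M, c, k => x.
suff E : @step M g = @step M (fun=> [::]) by have := H x; rewrite /outputs_within E.
by apply/funext => -[q T]; rewrite /step ask0.
Qed.

Theorem theorem5p2 (R : realType) (A B : set word) (g : word -> word) :
  selective g B -> poly_m_reducible A B -> dim_p R g A = 0%E.
Proof.
move=> [f [gf fB]] [h [ph hAB]]; have gh := polytime_oracle_polytime g ph.
apply/eqP; rewrite eq_le; apply/andP; split; last first.
  by apply: le_ereal_inf_tmp => _ [s [s0 _] <-]; rewrite lee_fin.
apply/lee_addgt0Pr => e e0; rewrite add0e.
have [j lt_je] := exists_dexp_lt e0.
apply: ge_ereal_inf; exists (dexp R j)%:E; last by rewrite lee_fin ltW.
exists (dexp R j) => //; split.
  by rewrite divr_ge0 // ltW ?ln_gt0 ?ltr1n // base_gt1.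
exists (dgale R h f j); split; first exact: dgale_gale.
- exact: dgale_polytime.
- exact: (@dgale_succeeds R h f j A B hAB fB).
Qed.
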